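(* Let $(\mathbb{R}^n,g)$ be a pseudo-Euclidean space, $n\ge3$, with coordinates $x=(x_1,\dots,x_n)$ and $g_{ij}=\delta_{ij}\varepsilon_i$, $\varepsilon_i=\pm1$. Let $\xi=\sum_{i=1}^n\alpha_ix_i$ with $\alpha_i\in\mathbb{R}$ and $\sum_{i=1}^n\varepsilon_i\alpha_i^2=\varepsilon_{i_0}\in\{1,-1\}$. Let $m,r\in\mathbb{N}$ with $m,r\ge1$, let $k>0$, put $a=(n-2)k-m$, $b=m(2k+1)-(n-2)k^2$, and $$v(z)=\frac{r(a-rz)}{r(r-1)z^2-2r(k+a)z+a^2-b}.$$ Let $x(\xi)$ and $z(\xi)$, with $z$ a non-constant smooth function, be given on an open interval $I$ of values of $\xi$ by $$\begin{cases}v(z)z'-c(a-rz)e^{\int v(z)\,dz}=0,\qquad c>0,\\ x=c\,e^{\int v(z)\,dz}.\end{cases}$$ Let $f(\xi)$, $\varphi(\xi)$ and $h(\xi)$ be functions obtained by integrating $$\frac{f'}{f}(\xi)=x(\xi),\qquad\frac{\varphi'}{\varphi}(\xi)=kx(\xi),\qquad\frac{h'}{h}(\xi)=x(\xi)z(\xi).$$ Then, for any Ricci-flat semi-Riemannian manifold $(F^m,g_F)$ of dimension $m$, $(\mathbb{R}^n\times_fF^m,\widetilde g,h)$ is a quasi-Einstein semi-Riemannian manifold with $\rho=0$, where $\widetilde g=\overline g+f^2g_F$ and $\overline g=\frac1{\varphi^2}g$; i.e. $\mathrm{Ric}_{\widetilde g}-\frac rh\mathrm{Hess}_{\widetilde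 g}h=0$ on the warped product over the open set where $\xi\in I$.
   Context: Primes denote derivatives with respect to $\xi$. $\int v(z)\,dz$ denotes a fixed antiderivative $V$ of $v$ on an interval on which the denominator of $v$ does not vanish and which contains the values of $z(\xi)$; thus $x(\xi)=c\,e^{V(z(\xi))}$. The functions $f,\varphi,h$ are nowhere zero with $f>0$. The warped product of an open set $U\subset\mathbb{R}^n$ with metric $\overline g$ and $(F^m,g_F)$ with warping function $f$ is $U\times F$ with the metric $\overline g+f^2g_F$ (written $\mathbb{R}^n\times_fF^m$); functions of $\xi$ are regarded as functions on it via the projection. A semi-Riemannian manifold $(M,\widetilde g)$ with a nowhere zero smooth function $h$ is quasi-Einstein if $\mathrm{Ric}_{\widetilde g}-\frac rh\mathrm{Hess}_{\widetilde g}h=\rho\,\widetilde g$ for a constant $\rho$. *)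

(* Defs.v *)
From HB Require Import structures.
From mathcomp Require Import all_boot all_order all_algebra.
From mathcomp Require Import all_classical all_reals all_analysis.
Set Implicit Arguments.
Unset Strict Implicit.
Unset Printing Implicit Defensive.
Import Order.TTheory GRing.Theory Num.Theory.
Import numFieldNormedType.Exports.
Local Open Scope ring_scope.
Local Open Scope classical_set_scope.

Section Coordinates.
Context {R : realType} {d : nat}.
Implicit Types (U : set 'rV[R]_d) (F : 'rV[R]_d -> R) (G : 'rV[R]_d -> 'M[R]_d).

Definition partial (i : 'I_d) F : 'rV[R]_d -> R := 'D_(delta_mx 0 i) F.

(* Meant for open U. *)
Fixpoint Ck (k : nat) U F : Prop :=
  (forall y, U y -> {for y, continuous F}) /\
  if k is k'.+1 then
    forall i, (forall y, U y -> derivable F y (delta_mx 0 i)) /\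
              Ck k' U (partial i F)
  else True.

Definition smooth_on U F : Prop := forall k, Ck k U F.

Definition christoffel G (l i j : 'I_d) (y : 'rV[R]_d) : R :=
  2^-1 * \sum_(s < d) invmx (G y) l s *
    (partial i (fun x => G x j s) y + partial j (fun x => G x i s) y
     - partial s (fun x => G x i j) y).

(* The contraction R^s_{isj} of the curvature tensor, with the sign for which
   round spheres have positive Ricci curvature. *)
Definition ricci G (y : 'rV[R]_d) : 'M[R]_d :=
  \matrix_(i, j) \sum_(s < d)
    (partial s (christoffel G s i j) y - partial j (christoffel G s s i) y
     + \sum_(t < d) (christoffel G s s t y * christoffel G t i j y
                     - christoffel G s j t y * christoffel G t s i y)).

Definition hessian G F (y : 'rV[R]_d) : 'M[R]_d :=
  \matrix_(i, j) (partial i (partial j F) y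
    - \sum_(s < d) christoffel G s i j y * partial s F y).

End Coordinates.

(* A chart is a total function, of which only the values on its domain are
   meaningful; the axioms are in smooth_manifold. *)
Record atlas (R : realType) (d : nat) := Atlas {
  pts : topologicalType;
  idx : Type;
  dom : idx -> set pts;
  chart : idx -> pts -> 'rV[R]_d
}.

Section Manifolds.
Context {R : realType} {d : nat} (A : atlas R d).

(* q \o (chart i)^-1 on chart i @` dom i, and 0 elsewhere. *)
Definition coord_rep {V : zmodType} (i : idx A) (q : pts A -> V)
    (y : 'rV[R]_d) : V :=
  xget 0 [set w | exists p, [/\ dom i p, chart i p = y & q p = w]].

Definition transition (i j : idx A) : 'rV[R]_d -> 'rV[R]_d :=
  coord_rep i (chart j).

Definition smooth_manifold : Prop :=
  [/\ hausdorff_space (pts A),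
      @second_countable (pts A),
      forall p : pts A, exists i, dom i p,
      forall i : idx A,
        [/\ open (dom i),
            forall p q, dom i p -> dom i q -> chart i p = chart i q -> p = q,
            forall p, dom i p -> {for p, continuous (chart i)} &
            forall W, open W -> W `<=` dom i -> open (chart i @` W)] &
      forall (i j : idx A) (b : 'I_d),
        smooth_on (chart i @` (dom i `&` dom j))
                  (fun y => transition i j y 0 b)].

Definition smooth_function (q : pts A -> R) : Prop :=
  forall i, smooth_on (chart i @` dom i) (coord_rep i q).

(* A (0,2)-tensor field is given by its matrix of components at p in the
   coordinate frame of the chart i, for p in dom i. *)
Definition tensor2 : Type := idx A -> pts A -> 'M[R]_d.

Definition transition_jacobian (i j : idx A) (p : pts A) : 'M[R]_d :=
  \matrix_(a, b) partial a (fun y => transition i j y 0 b) (chart i p).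

(* The last clause says that the index is constant: the rows of P form an
   orthonormal basis of the tangent space at p with causal characters eta. *)
Definition semi_riemannian (g : tensor2) : Prop :=
  [/\ smooth_manifold,
      forall i a b, smooth_on (chart i @` dom i)
                              (fun y => coord_rep i (g i) y a b),
      forall i j p, dom i p -> dom j p ->
        g i p = transition_jacobian i j p *m g j p
                *m (transition_jacobian i j p)^T,
      forall i p, dom i p -> (g i p)^T = g i p /\ g i p \in unitmx &
      exists2 eta : 'rV[R]_d, forall a, eta 0 a = 1 \/ eta 0 a = -1 &
        forall i p, dom i p -> exists2 P : 'M[R]_d, P \in unitmx &
          P *m g i p *m P^T = diag_mx eta].

Definition ricci_tensor (g : tensor2) : tensor2 :=
  fun i p => ricci (coord_rep i (g i)) (chart i p).

Definition hessian_tensor (g : tensor2) (q : pts A -> R) : tensor2 :=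
  fun i p => hessian (coord_rep i (g i)) (coord_rep i q) (chart i p).

Definition ricci_flat (g : tensor2) : Prop :=
  forall i p, dom i p -> ricci_tensor g i p = 0.

Definition quasi_einstein (g : tensor2) (h : pts A -> R) (r rho : R) : Prop :=
  [/\ semi_riemannian g,
      smooth_function h,
      forall p, h p != 0 &
      forall i p, dom i p ->
        ricci_tensor g i p - (r / h p) *: hessian_tensor g h i p
        = rho *: g i p].

End Manifolds.

Section Constructions.
Context {R : realType}.

(* The subset U of R^n with its subspace topology and its inclusion as the
   only chart. *)
Definition euclidean_subset {n} (U : set 'rV[R]_n) : atlas R n :=
  {| pts := (U : Type);
     idx := unit;
     dom := fun=> setT;
     chart := fun=> set_val |}.

Definition product_atlas {n m} (B : atlas R n) (F : atlas R m) :
    atlas R (n + m) :=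
  {| pts := (pts B * pts F)%type;
     idx := (idx B * idx F)%type;
     dom := fun i => dom i.1 `*` dom i.2;
     chart := fun i p => row_mx (chart i.1 p.1) (chart i.2 p.2) |}.

Definition warped_metric {n m} (B : atlas R n) (F : atlas R m)
    (gB : tensor2 B) (gF : tensor2 F) (f : pts B -> R) :
    tensor2 (product_atlas B F) :=
  fun i p => block_mx (gB i.1 p.1) 0 0 (f p.1 ^+ 2 *: gF i.2 p.2).

(* g / phi^2 for the pseudo-Euclidean metric g with signs eps. *)
Definition conformal_metric {n} (U : set 'rV[R]_n) (eps : 'rV[R]_n)
    (phi : pts (euclidean_subset U) -> R) : tensor2 (euclidean_subset U) :=
  fun _ p => (phi p ^+ 2)^-1 *: diag_mx eps.

Definition linear_form {n} (alpha y : 'rV[R]_n) : R :=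
  \sum_(i < n) alpha 0 i * y 0 i.

End Constructions.

(* Main.v *)
Require Import Defs.
From HB Require Import structures.
From mathcomp Require Import all_boot all_order all_algebra.
From mathcomp Require Import all_classical all_reals all_analysis.
From mathcomp Require Import ring lra.
Set Implicit Arguments.
Unset Strict Implicit.
Unset Printing Implicit Defensive.
Import Order.TTheory GRing.Theory Num.Theory.
Import numFieldNormedType.Exports.
Local Open Scope ring_scope.
Local Open Scope classical_set_scope.

(* With P = phi'/phi, Q = f'/f, S = h'/h and e0 = <alpha, alpha>, the nonzero
   blocks of Ric - (r/h) Hess h on the warped product are
     alpha_i alpha_j [(n-2)(P' + P^2) - m (Q' + Q^2 + 2PQ) - r (S' + S^2 + 2PS)]
       + e0 eps_i delta_ij [P' - (n-2) P^2 + m PQ + r PS]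
   on the base and
     Ric_F + e0 phi^2 f^2 g_F [(n-2) PQ - Q' - m Q^2 - r QS]
   on the fibre.  For P = k x, Q = x, S = x z the three brackets vanish as soon
   as x' = (a - r z) x^2 and r z' = x den(z).
   The second equation is the given system divided by a - r z.  It persists
   where a - r z = 0: at every point z' = 0 or r z' = x den(z), since otherwise
   z is constant near that point; by continuity the same alternative holds on
   the whole interval, and z is not constant.  As then z' vanishes nowhere,
   z takes its values in the interior of J, where V' = v, and the first
   equation follows by differentiating x = c exp(V(z)).  Smoothness of x, phi,
   f, h is a bootstrap on their differential equations. *)

(** * Smooth functions of one real variable *)

Section Curves.
Context {R : realType} {V W X : normedModType R}.

(** A directional derivative sees only the values along one line, so functions on different spaces
    can be compared as soon as they agree along two lines. Partial derivatives in product
    coordinates are reduced in this way to the factors or to [R]. *)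
Lemma derivable_curve (f : V -> X) (g : W -> X) (a v : V) (b w : W) :
  (forall t : R, f (t *: v + a) = g (t *: w + b)) ->
  derivable f a v -> derivable g b w.
Proof.
(* At [t = 0] this gives [f a = g b], the value subtracted in the difference quotient. *)
move=> fg; have := fg 0; rewrite !scale0r !add0r /derivable => fga.
by under [X in cvg (X @ _) -> _]eq_fun do rewrite /= fg fga.
Qed.

Lemma derive_curve (f : V -> X) (g : W -> X) (a v : V) (b w : W) :
  (forall t : R, f (t *: v + a) = g (t *: w + b)) -> 'D_v f a = 'D_w g b.
Proof.
move=> fg; have := fg 0; rewrite !scale0r !add0r /derive => fga.
by under [in LHS]eq_fun do rewrite /= fg fga.
Qed.

End Curves.

Section RealFunctions.
Context {R : realType}.
Implicit Types (I : set R) (f g : R -> R).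

Lemma derive_real_dir f (t c : R) :
  derivable f t 1 -> derivable f t c /\ 'D_c f t = c * (derive1 f) t.
Proof.
move=> /derivable1_diffP df; split; first exact: diff_derivable.
by rewrite deriveE// derive1E' // -[in LHS](mulr1 c) -[c * 1]/(c *: 1) linearZ.
Qed.

Lemma derivable1_cont f (t : R) : derivable f t 1 -> {for t, continuous f}.
Proof. by move=> /derivable1_diffP/differentiable_continuous. Qed.

(** Finite orders are tracked separately because the bootstrap on a differential equation gains one
    order at a time. Continuity is not recorded, as derivability implies it. *)
Fixpoint derivable_upto (k : nat) I f : Prop :=
  if k is k'.+1 then
    (forall t, I t -> derivable f t 1) /\ derivable_upto k' I (derive1 f)
  else True.

Definition smooth1 I f := forall k, derivable_upto k I f.

Lemma derivable_upto_iter I f :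
  (forall j t, I t -> derivable (derive1n j f) t 1) -> smooth1 I f.
Proof.
move=> df k; elim: k f df => [//|k IH] f df; split; first exact: (df 0%N).
by apply: IH => j t It; rewrite -derive1Sn; exact: df.
Qed.

Lemma derive1_eq_on I f g : open I -> {in I, f =1 g} ->
  forall t, I t -> (derive1 f) t = (derive1 g) t.
Proof.
move=> Io fg t It; rewrite !derive1E; apply: near_eq_derive.
by apply: filterS (open_nbhs_nbhs (conj Io It)) => s Is; rewrite fg // inE.
Qed.

Lemma derivable_eq_on I f g : open I -> {in I, f =1 g} ->
  forall t, I t -> derivable f t 1 -> derivable g t 1.
Proof.
move=> Io fg t It; apply: near_eq_derivable.
by apply: filterS (open_nbhs_nbhs (conj Io It)) => s Is; rewrite fg // inE.
Qed.

Lemma derivable_upto_eq k I f g : open I -> {in I, f =1 g} ->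
  derivable_upto k I f -> derivable_upto k I g.
Proof.
move=> Io; elim: k f g => [//|k IH] f g fg [df df']; split.
  by move=> t It; apply: (derivable_eq_on Io fg It); exact: df.
by apply: IH df' => t /set_mem It; exact: (derive1_eq_on Io fg).
Qed.

Lemma derivable_upto_le k I f : derivable_upto k.+1 I f -> derivable_upto k I f.
Proof. by elim: k f => [//|k IH] f [df /IH]. Qed.

Lemma derivable_upto_cst k I (c : R) : derivable_upto k I (cst c).
Proof.
elim: k c => [//|k IH] c; split; first by move=> t _; exact: derivable_cst.
suff -> : derive1 (cst c : R -> R) = cst 0 by exact: IH.
by apply/funext => t; rewrite derive1_cst.
Qed.

Lemma derivable_uptoD k I f g : open I ->
  derivable_upto k I f -> derivable_upto k I g ->
  derivable_upto k I (fun t => f t + g t).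
Proof.
move=> Io; elim: k f g => [//|k IH] f g [df df'] [dg dg']; split.
  by move=> t It; apply: derivableD; [exact: df|exact: dg].
apply: (derivable_upto_eq Io _ (IH _ _ df' dg')) => t /set_mem It.
by rewrite !derive1E -[RHS]/('D_1 (f + g) t) deriveD //; [exact: df|exact: dg].
Qed.

Lemma derivable_uptoM k I f g : open I ->
  derivable_upto k I f -> derivable_upto k I g ->
  derivable_upto k I (fun t => f t * g t).
Proof.
move=> Io; elim: k f g => [//|k IH] f g dkf dkg.
have [df df'] := dkf; have [dg dg'] := dkg; split.
  by move=> t It; apply: derivableM; [exact: df|exact: dg].
(* In each Leibniz term the undifferentiated factor is first lowered to order [k], so that the
   induction hypothesis applies to both products. *)
apply: (derivable_upto_eq Io _ (derivable_uptoD Io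
   (IH _ _ (derivable_upto_le dkf) dg') (IH _ _ (derivable_upto_le dkg) df'))).
move=> t /set_mem It.
by rewrite !derive1E -[RHS]/('D_1 (f * g) t) deriveM //; [exact: df|exact: dg].
Qed.

Lemma smooth1_cst I (c : R) : smooth1 I (cst c).
Proof. by move=> k; exact: derivable_upto_cst. Qed.

Lemma smooth1D I f g : open I -> smooth1 I f -> smooth1 I g ->
  smooth1 I (fun t => f t + g t).
Proof. by move=> Io sf sg k; exact: derivable_uptoD. Qed.

Lemma smooth1M I f g : open I -> smooth1 I f -> smooth1 I g ->
  smooth1 I (fun t => f t * g t).
Proof. by move=> Io sf sg k; exact: derivable_uptoM. Qed.

Lemma smooth1_derivable I f : smooth1 I f -> forall t, I t -> derivable f t 1.
Proof. by move=> /(_ 1%N) []. Qed.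

Lemma smooth1_derive I f : smooth1 I f -> smooth1 I (derive1 f).
Proof. by move=> sf k; have [] := sf k.+1. Qed.

(** Bootstrap: if [f] has order [k], so has [f' = g f], hence [f] has order [k + 1]. *)
Lemma smooth1_ode I f g : open I -> smooth1 I g ->
  (forall t, I t -> is_derive t 1 f (g t * f t)) -> smooth1 I f.
Proof.
move=> Io sg fE; elim=> [//|k IH]; split=> [t /fE []//|].
apply: (derivable_upto_eq Io _ (derivable_uptoM Io (sg k) IH)).
by move=> t /set_mem /fE [_ fE']; rewrite derive1E.
Qed.

(* The Bernoulli equation [f' = g * f ^+ 2] read as the linear equation
   [f' = (g * f) * f], whose coefficient is as regular as [f]. *)
Lemma smooth1_bernoulli I f g : open I -> smooth1 I g ->
  (forall t, I t -> is_derive t 1 f (g t * f t ^+ 2)) -> smooth1 I f.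
Proof.
move=> Io sg fE; elim=> [//|k IH]; split=> [t /fE []//|].
apply: (derivable_upto_eq Io _
  (derivable_uptoM Io (derivable_uptoM Io (sg k) IH) IH)).
by move=> t /set_mem /fE [_ fE']; rewrite derive1E fE' expr2 mulrA.
Qed.

End RealFunctions.

(** * The differential system *)

Section Intervals.
Context {R : realType}.
Implicit Types (I J : set R) (f : R -> R).

Lemma open_itv_nbhs I (t : R) : open I -> I t ->
  exists2 e, 0 < e & forall s, t - e <= s <= t + e -> I s.
Proof.
move=> Io It; have /nbhs_ballP [e /= e0 eI] := open_nbhs_nbhs (conj Io It).
exists (e / 2) => [|s /andP[h1 h2]]; first lra.
by apply: eI; rewrite /ball /= ltr_norml; apply/andP; split; lra.
Qed.

Lemma derive0_cst_itv I f :
  is_interval I -> (forall t, I t -> is_derive t 1 f 0) ->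
  forall s t, I s -> I t -> f s = f t.
Proof.
move=> hI df.
have H s t : I s -> I t -> s <= t -> f s = f t.
  move=> Is It st.
  have sub u : u \in `[s, t]%R -> I u by rewrite in_itv /=; exact: hI Is It u.
  have [u uin||u uin] := @MVT_segment R f (fun=> 0) s t st.
  - by apply: df; apply: sub; exact: subset_itv_oo_cc uin.
  - by apply: derivable_within_continuous => u /sub /df [].
  - by move/eqP; rewrite mul0r subr_eq0 => /eqP.
by move=> s t Is It; have /orP[st|ts] := le_total s t; [exact: H|rewrite (H t s)].
Qed.

(** Taking both values would force the value [1/2] in between, by the intermediate value theorem. *)
Lemma two_valued_cst I f :
  is_interval I -> (forall t, I t -> {for t, continuous f}) ->
  (forall t, I t -> f t = 0 \/ f t = 1) ->
  forall s t, I s -> I t -> f s = f t.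
Proof.
move=> hI cf f01.
have H s t : I s -> I t -> s <= t -> f s = f t.
  move=> Is It st.
  have sub u : u \in `[s, t]%R -> I u by rewrite in_itv /=; exact: hI Is It u.
  have cst : {within `[s, t], continuous f}.
    apply: continuous_in_subspaceT => u uin.
    by apply: cf; apply: sub; move: uin; rewrite inE.
  have half u : I u -> f u != 2^-1.
    by move=> /f01 [] ->; [rewrite lt_eqF//|rewrite gt_eqF//]; lra.
  have [fs|fs] := f01 _ Is; have [ft|ft] := f01 _ It; rewrite ?fs ?ft//.
    have [|u /sub/half/eqP + fu //] := @IVT R f s t 2^-1 st cst.
    by rewrite fs ft /Num.min /Num.max ltr01; apply/andP; split; lra.
  have [|u /sub/half/eqP + fu //] := @IVT R f s t 2^-1 st cst.
  by rewrite fs ft /Num.min /Num.max ltr10; apply/andP; split; lra.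
by move=> s t Is It; have /orP[st|ts] := le_total s t; [exact: H|rewrite (H t s)].
Qed.

(** By Fermat's criterion a nonzero derivative keeps [f t] from being a local extremum, so [J] has
    points on both sides of it. This gives access to [V' = v], which is known only in the interior
    of [J]. *)
Lemma interior_of_derive_neq0 I J f (t : R) :
  open I -> is_interval J -> (forall s, I s -> derivable f s 1) ->
  (forall s, I s -> J (f s)) -> I t -> derive1 f t != 0 -> (interior J) (f t).
Proof.
move=> Io hJ df fJ It f'0.
have [e e0 eI] := open_itv_nbhs Io It.
have dfe s : s \in `]t - e, t + e[%R -> derivable f s 1.
  by rewrite in_itv /= => /andP[? ?]; apply/df/eI/andP; split; exact: ltW.
have tin : t \in `]t - e, t + e[%R by rewrite in_itv /=; apply/andP; split; lra.
have lee : t - e <= t + e by lra.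
have Ie s : s \in `]t - e, t + e[%R -> I s.
  by rewrite in_itv /= => /andP[? ?]; apply: eI; apply/andP; split; exact: ltW.
have [q Jq fq] : exists2 q, J q & f t < q.
  apply: contrapT => noq; move/eqP: f'0; apply; rewrite derive1E.
  apply: derive_val; apply: (derive1_at_max lee dfe tin) => s /Ie Is.
  by rewrite leNgt; apply/negP => fs; apply: noq; exists (f s) => //; exact: fJ.
have [p Jp fp] : exists2 p, J p & p < f t.
  apply: contrapT => nop; move/eqP: f'0; apply; rewrite derive1E.
  apply: derive_val; apply: (derive1_at_min lee dfe tin) => s /Ie Is.
  by rewrite leNgt; apply/negP => fs; apply: nop; exists (f s) => //; exact: fJ.
have : nbhs (f t) `]p, q[%classic.
  by apply: open_nbhs_nbhs; split; [exact: interval_open|rewrite /= in_itv /= fp fq].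
apply: filterS => s; rewrite /= in_itv /= => /andP[ps sq].
by apply: hJ Jp Jq _ _; rewrite !ltW.
Qed.

End Intervals.

Section System.
Context {R : realType}.
Variables (I J : set R) (z V v den : R -> R) (r c a : R).
Hypotheses (r0 : 0 < r) (c0 : 0 < c) (Io : open I) (hI : is_interval I)
  (hJ : is_interval J) (dz : smooth1 I z)
  (znc : exists s t, [/\ I s, I t & z s != z t])
  (denJ : forall t, J t -> den t != 0) (zJ : forall t, I t -> J (z t))
  (cden : continuous den)
  (vE : forall t, v t = r * (a - r * t) / den t)
  (cV : {within J, continuous V})
  (dV : forall t : R, interior J t -> is_derive t 1 V (v t))
  (sys : forall t, I t ->
    v (z t) * derive1 z t - c * (a - r * z t) * expR (V (z t)) = 0).

(** The value that the first equation forces on [z'] wherever [a - r z] is nonzero. *)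
Let w t := c * expR (V (z t)) * den (z t) / r.

Let dz1 t : I t -> derivable z t 1. Proof. exact: smooth1_derivable. Qed.

Let cz t : I t -> {for t, continuous z}.
Proof. by move=> It; apply: derivable1_cont; exact: dz1. Qed.

Let cz' t : I t -> {for t, continuous (derive1 z)}.
Proof.
move=> It; apply: derivable1_cont.
exact: (smooth1_derivable (smooth1_derive dz)).
Qed.

Let w_neq0 t : I t -> w t != 0.
Proof.
move=> It; rewrite /w !mulf_neq0 ?invr_neq0 ?denJ ?gt_eqF ?expR_gt0 //.
exact: zJ.
Qed.

Let w_cont t : I t -> {for t, continuous w}.
Proof.
move=> It; apply: cvgM; last exact: cvg_cst.
apply: cvgM; last by apply: continuous_comp; [exact: cz|exact: cden].
apply: cvgM; first exact: cvg_cst.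
apply: continuous_comp; last exact: continuous_expR.
(* [V] is continuous only relative to [J]. This suffices, since [z] maps the open set [I] into
   [J]. *)
move/subspace_continuousP: cV => /(_ (z t) (zJ It)) cVt.
move=> A /cVt [e /= e0 eA].
have zt : nbhs t (fun s => I s /\ ball (z t) e (z s)).
  apply: filterI; first exact: open_nbhs_nbhs.
  by apply: (cz It); exact: nbhsx_ballx.
by apply: filterS zt => s [Is zs]; apply: eA => //; exact: zJ.
Qed.

(* Where [a - r z] vanishes the first equation is void.  If the second
   alternative fails at [t], then it fails near [t], so [z] is constant equal
   to [a / r] near [t]. *)
Let z'_dich t : I t -> derive1 z t = 0 \/ derive1 z t = w t.
Proof.
move=> It; have [|zw] := eqVneq (derive1 z t) (w t); first by right.
left; have nw : \forall s \near t, z s = cst (a / r) s.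
  have dzw : {for t, continuous (fun s => derive1 z s - w s)}.
    by apply: cvgB; [exact: cz'|exact: w_cont].
  have : nbhs t (fun s => derive1 z s - w s != 0).
    apply: (dzw [set u | u != 0]); apply: open_nbhs_nbhs.
    by split; [exact: open_neq|rewrite /= subr_eq0].
  apply: filterS2 (open_nbhs_nbhs (conj Io It)) => s Is zws.
  have := sys Is; rewrite vE => /eqP.
  have -> : r * (a - r * z s) / den (z s) * derive1 z s
            - c * (a - r * z s) * expR (V (z s))
          = r / den (z s) * (a - r * z s) * (derive1 z s - w s).
    rewrite /w; field; rewrite gt_eqF // andTb.
    by apply: denJ; exact: zJ.
  rewrite !mulf_eq0 (negPf zws) orbF invr_eq0.
  rewrite (negPf (denJ (zJ Is))) gt_eqF //= subr_eq0 => /eqP ->.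
  by rewrite /cst mulrC mulKf // gt_eqF.
by rewrite derive1E (near_eq_derive _ nw) derive_cst.
Qed.

(** The quotient [z' / w] is continuous with values in {0, 1}, hence constant on the interval; the
    constant 0 would make [z] constant. *)
Lemma system_derive_z t : I t -> derive1 z t = w t.
Proof.
pose s t := derive1 z t / w t.
have s01 u : I u -> s u = 0 \/ s u = 1.
  move=> Iu; rewrite /s; have [->|->] := z'_dich Iu; first by left; rewrite mul0r.
  by right; rewrite divff // w_neq0.
have cs u : I u -> {for u, continuous s}.
  move=> Iu; apply: cvgM; first exact: cz'.
  by apply: cvgV; [exact: w_neq0|exact: w_cont].
have scst := two_valued_cst hI cs s01.
have [t0 [It0 st0]] : exists t0, I t0 /\ s t0 = 1.
  apply: contrapT => no1; have [p [q [Ip Iq /eqP]]] := znc; apply.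
  apply: (derive0_cst_itv hI) Ip Iq => u Iu.
  apply: DeriveDef; first exact: dz1.
  have [/eqP|su] := s01 _ Iu; last by exfalso; apply: no1; exists u.
  rewrite /s mulf_eq0 invr_eq0 (negPf (w_neq0 Iu)) orbF => /eqP.
  by rewrite derive1E.
move=> It; have := scst _ _ It It0; rewrite st0 /s => /(canRL (divfK (w_neq0 It))).
by rewrite mul1r.
Qed.

(** Chain rule: the logarithmic derivative is [v(z) z'], and with [z' = w] the factors [den] and [r]
    cancel, leaving [(a - r z) c exp(V(z))]. *)
Lemma system_derive_x t : I t ->
  is_derive t 1 (fun s => c * expR (V (z s)))
    ((a - r * z t) * (c * expR (V (z t))) ^+ 2).
Proof.
move=> It; have z'E := system_derive_z It.
have Jzt : (interior J) (z t).
  apply: (interior_of_derive_neq0 Io hJ _ zJ It); first exact: dz1.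
  by rewrite z'E w_neq0.
have dVz := dV Jzt.
have dzt : is_derive t 1 z (w t).
  by apply: DeriveDef; [exact: dz1|rewrite -derive1E].
have dVzt : is_derive t 1 (V \o z) (v (z t) * w t) by exact: is_derive1_comp.
have de := is_derive1_comp (is_derive_expR ((V \o z) t)) dVzt.
apply: (is_derive_eq (is_deriveZ c de)).
rewrite /w vE /= -[_ *: _]/(_ * _); field.
by rewrite gt_eqF //= (denJ (zJ It)).
Qed.

End System.

(** * Topology of products and subsets *)

Section SecondCountable.

Lemma second_countable_prod (S T : topologicalType) :
  @second_countable S -> @second_countable T -> @second_countable (S * T)%type.
Proof.
move=> [B cB [Bo Bb]] [C cC [Co Cb]].
pose box (p : set S * set T) := p.1 `*` p.2.
exists (box @` (B `*` C)).
  by apply: sub_countable (card_image_le _ _) _; exact: countableX.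
split=> [_ [[U V] [/= BU CV] <-]|[s t] W [[P Q] [/= sP tQ] PQW]].
  rewrite openE => -[s t] [/= Us Vt]; exists (U, V) => //; split.
    by apply: open_nbhs_nbhs; split=> //; exact: Bo.
  by apply: open_nbhs_nbhs; split=> //; exact: Co.
have [U [BU Us] UP] := Bb s P sP; have [V [CV Vt] VQ] := Cb t Q tQ.
exists (U `*` V); first by split=> //; exists (U, V).
by move=> [s' t'] [/= Us' Vt']; apply: PQW; split; [exact: UP|exact: VQ].
Qed.

Lemma second_countable_set_type (T : topologicalType) (A : set T) :
  @second_countable T -> @second_countable (A : Type).
Proof.
move=> [B cB [Bo Bb]]; exists [set (set_val @^-1` U : set A) | U in B].
  exact: sub_countable (card_image_le _ _) cB.
split=> [_ [U BU <-]|p S]; first by exists U => //; exact: Bo.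
rewrite nbhsE => -[_ [[W oW <-] /= Wp] WS].
have [U [BU Up] UW] := Bb (set_val p) W (open_nbhs_nbhs (conj oW Wp)).
by exists (set_val @^-1` U); [split; [exists U|]|move=> q /UW /WS].
Qed.

(** The open boxes with rational corners form a countable basis. *)
Lemma second_countable_rV (R : realType) n : @second_countable 'rV[R]_n.
Proof.
pose box (ab : 'rV[rat]_n * 'rV[rat]_n) :=
  [set y : 'rV[R]_n | forall i, ratr (ab.1 0 i) < y 0 i < ratr (ab.2 0 i)].
exists (range box); first exact: (sub_countable (card_image_le _ _)).
split=> [_ [ab _ <-]|y S [P yP PS]].
  rewrite openE => y aby; exists (fun _ i => `]ratr (ab.1 0 i), ratr (ab.2 0 i)[%classic).
    move=> i j; rewrite ord1; apply: open_nbhs_nbhs; split.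
      exact: interval_open.
    by rewrite /= in_itv; exact: aby.
  by move=> y' H i; have := H 0 i; rewrite /= in_itv.
have /choice [ab abP] : forall i, exists ab : rat * rat,
    ratr ab.1 < y 0 i < ratr ab.2 /\
    forall s : R, ratr ab.1 < s < ratr ab.2 -> P 0 i s.
  move=> i; have /nbhs_ballP [e /= e0 eP] := yP 0 i.
  have [|a ain] := @rat_in_itvoo R (y 0 i - e) (y 0 i); first lra.
  have [|b bin] := @rat_in_itvoo R (y 0 i) (y 0 i + e); first lra.
  move: ain bin; rewrite !in_itv /= => /andP[a1 a2] /andP[b1 b2].
  exists (a, b); split=> [|s /andP[/= as_ sb]]; first by rewrite /= a2 b1.
  by apply: eP; rewrite /ball /= ltr_norml; apply/andP; split; lra.
exists (box (\row_i (ab i).1, \row_i (ab i).2)).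
  split; first by exists (\row_i (ab i).1, \row_i (ab i).2).
  by move=> i; rewrite /= !mxE; have [] := abP i.
move=> y' H; apply: PS => i j; rewrite ord1; have [_] := abP j; apply.
by have := H j; rewrite !mxE.
Qed.

End SecondCountable.

Lemma hausdorff_set_type (T : topologicalType) (A : set T) :
  hausdorff_space T -> hausdorff_space (A : Type).
Proof.
move=> hT p q pq; apply: val_inj; apply: hT => U V pU qV.
have nval (x : A) W : nbhs (val x) W -> nbhs x (set_val @^-1` W).
  by move=> xW; exact: (@initial_continuous A T set_val x).
have [x [Ux Vx]] := pq _ _ (nval _ _ pU) (nval _ _ qV).
by exists (set_val x).
Qed.

Lemma hausdorff_prod (S T : topologicalType) :
  hausdorff_space S -> hausdorff_space T -> hausdorff_space (S * T)%type.
Proof.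
move=> hS hT [s t] [s' t'] st; congr pair.
  apply: hS => U V sU sV.
  have [||[p q] [[/= pU _] [pV _]]] := st (U `*` setT) (V `*` setT).
  - by exists (U, setT) => //; split => //; exact: filterT.
  - by exists (V, setT) => //; split => //; exact: filterT.
  - by exists p.
apply: hT => U V sU sV.
have [||[p q] [[/= _ pU] [_ pV]]] := st (setT `*` U) (setT `*` V).
- by exists (setT, U) => //; split => //; exact: filterT.
- by exists (setT, V) => //; split => //; exact: filterT.
- by exists q.
Qed.

Section Blocks.
Context {R : realType} {n m : nat}.

Lemma row_mx_cvg (X : Type) (F : set_system X) (FF : Filter F)
    (f : X -> 'rV[R]_n) (g : X -> 'rV[R]_m) (u : 'rV[R]_n) (w : 'rV[R]_m) :
  f @ F --> u -> g @ F --> w ->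
  (fun x => row_mx (f x) (g x)) @ F --> row_mx u w.
Proof.
move=> fu gw A [P Pn PA].
have fP : (\forall x \near F, forall j, P 0 (lshift m j) (f x 0 j)).
  apply: (fu [set y | forall j, P 0 (lshift m j) (y 0 j)]).
  exists (fun i j => P i (lshift m j)) => [i j|y H j]; last exact: H.
  by have := Pn i (lshift m j); rewrite row_mxEl.
have gP : (\forall x \near F, forall j, P 0 (rshift n j) (g x 0 j)).
  apply: (gw [set y | forall j, P 0 (rshift n j) (y 0 j)]).
  exists (fun i j => P i (rshift n j)) => [i j|y H j]; last exact: H.
  by have := Pn i (rshift n j); rewrite row_mxEr.
apply: filterS2 fP gP => x fP gP; apply: PA => i j; rewrite ord1.
by case: (split_ordP j) => j' ->; rewrite ?row_mxEl ?row_mxEr.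
Qed.

Lemma lsubmx_cont : continuous (fun y : 'rV[R]_(n + m) => lsubmx y).
Proof.
move=> y A [P Pn PA].
(* Neighbourhoods of a matrix are given entry by entry: the left columns inherit the conditions, the
   right ones are free. *)
exists (fun i j => if fintype.split j is inl j' then P i j' else setT) => [i j|y' H].
  case: (split_ordP j) => j' ->.
    by have := Pn i j'; rewrite mxE.
  exact: filterT.
by apply: PA => i j; have := H i (lshift m j); rewrite (unsplitK (inl _)) mxE.
Qed.

Lemma rsubmx_cont : continuous (fun y : 'rV[R]_(n + m) => rsubmx y).
Proof.
move=> y A [P Pn PA].
exists (fun i j => if fintype.split j is inr j' then P i j' else setT) => [i j|y' H].
  case: (split_ordP j) => j' ->.
    exact: filterT.
  by have := Pn i j'; rewrite mxE.
by apply: PA => i j; have := H i (rshift n j); rewrite (unsplitK (inr _)) mxE.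
Qed.

Lemma open_block (U : set 'rV[R]_n) (O : set 'rV[R]_m) :
  open U -> open O -> open [set y : 'rV[R]_(n + m) | U (lsubmx y) /\ O (rsubmx y)].
Proof.
move=> oU oO; apply: (@openI _ (lsubmx @^-1` U) (rsubmx @^-1` O)).
  by apply: open_comp oU => y _; exact: lsubmx_cont.
by apply: open_comp oO => y _; exact: rsubmx_cont.
Qed.

End Blocks.

(** * Smooth functions in product coordinates *)

Section Ck.
Context {R : realType} {d : nat}.
Implicit Types (U : set 'rV[R]_d) (F G : 'rV[R]_d -> R).

Lemma near_eq_on U F G y : open U -> U y -> {in U, F =1 G} ->
  \forall x \near y, F x = G x.
Proof.
move=> oU Uy FG; apply: filterS (open_nbhs_nbhs (conj oU Uy)) => x Ux.
by rewrite FG // inE.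
Qed.

Lemma near_eq_continuous F G y : (\forall x \near y, F x = G x) ->
  {for y, continuous F} -> {for y, continuous G}.
Proof.
move=> FG cF A; rewrite -(nbhs_singleton FG) => /cF FA.
by apply: filterS2 FG FA => x /= <-.
Qed.

Lemma partial_eq_on U F G i y : open U -> U y -> {in U, F =1 G} ->
  partial i F y = partial i G y.
Proof. by move=> oU Uy FG; apply: near_eq_derive; exact: near_eq_on FG. Qed.

(** On an open set partial derivatives depend only on nearby values, so equality on [U] passes to
    all of them. *)
Lemma Ck_eq k U F G : open U -> {in U, F =1 G} -> Ck k U F -> Ck k U G.
Proof.
move=> oU; elim: k F G => [|k IH] F G FG /= [cF dF]; split.
- by move=> y Uy; exact: near_eq_continuous (near_eq_on oU Uy FG) (cF _ Uy).
- by [].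
- by move=> y Uy; exact: near_eq_continuous (near_eq_on oU Uy FG) (cF _ Uy).
- move=> i; have [dFi CFi] := dF i; split=> [y Uy|].
    exact: near_eq_derivable (near_eq_on oU Uy FG) (dFi _ Uy).
  by apply: IH CFi => y /set_mem Uy; exact: partial_eq_on FG.
Qed.

Lemma Ck_cont k U F : Ck k U F -> forall y, U y -> {for y, continuous F}.
Proof. by case: k => [|k] []. Qed.

Lemma smooth_on_eq U F G : open U -> {in U, F =1 G} ->
  smooth_on U F -> smooth_on U G.
Proof. by move=> oU FG sF k; exact: Ck_eq FG (sF k). Qed.

Lemma smooth_on_cst U (c : R) : smooth_on U (cst c).
Proof.
move=> k; elim: k c => [|k IH] c; split => //.
- by move=> y _; exact: cst_continuous.
- by move=> y _; exact: cst_continuous.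
- move=> i; split; first by move=> y _; exact: derivable_cst.
  suff -> : partial i (cst c) = cst 0 by exact: IH.
  by apply/funext => y; exact: derive_cst.
Qed.

Lemma smooth_on_cont U F y : smooth_on U F -> U y -> {for y, continuous F}.
Proof. by move=> /(_ 0%N) [cF _]; exact: cF. Qed.

Lemma smooth_on_derivable U F i y : smooth_on U F -> U y ->
  derivable F y (delta_mx 0 i).
Proof. by move=> /(_ 1%N) [_ /(_ i) [+ _]]; apply. Qed.

Lemma smooth_on_partial U F i : smooth_on U F -> smooth_on U (partial i F).
Proof. by move=> sF k; have [_ /(_ i) []] := sF k.+1. Qed.

Lemma linear_form_cont (alpha : 'rV[R]_d) : continuous (linear_form alpha).
Proof.
apply: continuous_big => [|i _ y]; first exact: add_continuous.
apply: (@continuousM _ _ (cst (alpha 0 i)) (fun x : 'rV[R]_d => x 0 i)).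
  exact: cst_continuous.
exact: coord_continuous.
Qed.

Lemma linear_formD (alpha y v : 'rV[R]_d) (t : R) :
  linear_form alpha (t *: v + y) = t * linear_form alpha v + linear_form alpha y.
Proof.
rewrite /linear_form mulr_sumr -big_split /=; apply: eq_bigr => i _.
by rewrite !mxE; ring.
Qed.

Lemma linear_form_delta (alpha : 'rV[R]_d) i :
  linear_form alpha (delta_mx 0 i) = alpha 0 i.
Proof.
rewrite /linear_form (bigD1 i) //= big1 => [|j /negPf ji].
  by rewrite addr0 mxE !eqxx mulr1.
by rewrite mxE ji andbF mulr0.
Qed.

End Ck.

Section ProductCoordinates.
Context {R : realType} {n m : nat}.
Implicit Types (y : 'rV[R]_(n + m)) (t : R).

Lemma lsubmx_dirl y t i :
  lsubmx (t *: delta_mx 0 (lshift m i) + y) = t *: delta_mx 0 i + lsubmx y.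
Proof. by apply/rowP => j; rewrite !mxE (inj_eq (@lshift_inj _ _)). Qed.

Lemma rsubmx_dirl y t i :
  rsubmx (t *: delta_mx 0 (lshift m i) + y) = rsubmx y.
Proof. by apply/rowP => j; rewrite !mxE eq_rlshift andbF mulr0 add0r. Qed.

Lemma lsubmx_dirr y t i :
  lsubmx (t *: delta_mx 0 (rshift n i) + y) = lsubmx y.
Proof. by apply/rowP => j; rewrite !mxE eq_lrshift andbF mulr0 add0r. Qed.

Lemma rsubmx_dirr y t i :
  rsubmx (t *: delta_mx 0 (rshift n i) + y) = t *: delta_mx 0 i + rsubmx y.
Proof. by apply/rowP => j; rewrite !mxE (inj_eq (@rshift_inj _ _)). Qed.

Lemma partial_constl (A : 'rV[R]_(n + m) -> R) i y :
  (forall t, A (t *: delta_mx 0 i + y) = A y) -> partial i A y = 0.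
Proof.
move=> AE; rewrite /partial.
rewrite (@derive_curve _ _ _ _ A (cst (A y)) y _ (y : 'rV[R]_(n + m)) 0) => [|t].
  exact: derive_cst.
by rewrite AE.
Qed.

Lemma partial_lsubmx_l (A : 'rV[R]_n -> R) i y :
  partial (lshift m i) (fun x => A (lsubmx x)) y = partial i A (lsubmx y).
Proof. by apply: derive_curve => t; rewrite lsubmx_dirl. Qed.

Lemma partial_lsubmx_r (A : 'rV[R]_n -> R) i y :
  partial (rshift n i) (fun x => A (lsubmx x)) y = 0.
Proof. by apply: partial_constl => t; rewrite lsubmx_dirr. Qed.

Lemma partial_rsubmx_l (A : 'rV[R]_m -> R) i y :
  partial (lshift m i) (fun x => A (rsubmx x)) y = 0.
Proof. by apply: partial_constl => t; rewrite rsubmx_dirl. Qed.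

Lemma partial_rsubmx_r (A : 'rV[R]_m -> R) i y :
  partial (rshift n i) (fun x => A (rsubmx x)) y = partial i A (rsubmx y).
Proof. by apply: derive_curve => t; rewrite rsubmx_dirr. Qed.

(** Along the [i]-th direction the [j]-th coordinate is the identity of [R], run through with speed
    [(i == j)]. *)
Lemma partial_coord d (i j : 'I_d) (y : 'rV[R]_d) :
  derivable (fun x : 'rV[R]_d => x 0 j) y (delta_mx 0 i) /\
  partial i (fun x : 'rV[R]_d => x 0 j) y = (i == j)%:R.
Proof.
have curve t : t *: (i == j)%:R + y 0 j = (t *: delta_mx 0 i + y) 0 j :> R.
  by rewrite !mxE eqxx /= [j == i]eq_sym.
split.
  apply: (derivable_curve (f := id) (g := fun x : 'rV[R]_d => x 0 j) curve).
  exact: derivable_id.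
rewrite /partial.
rewrite -(derive_curve (f := id) (g := fun x : 'rV[R]_d => x 0 j) curve).
exact: derive_id.
Qed.

Lemma smooth_on_lcoord (U : set 'rV[R]_(n + m)) j : smooth_on U (fun y => lsubmx y 0 j).
Proof.
have -> : (fun y => lsubmx y 0 j) = (fun y : 'rV[R]_(n + m) => y 0 (lshift m j)).
  by apply/funext => y; rewrite mxE.
case=> [|k]; split => //.
- by move=> y _; exact: coord_continuous.
- by move=> y _; exact: coord_continuous.
- move=> i; split; first by move=> y _; have [] := partial_coord i (lshift m j) y.
  rewrite (_ : partial _ _ = cst (i == lshift m j)%:R); first exact: smooth_on_cst.
  by apply/funext => y; have [_ ->] := partial_coord i (lshift m j) y.
Qed.

Variable alpha : 'rV[R]_n.
Implicit Types (A : R -> R) (B : 'rV[R]_m -> R).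

(** A function of [xi] times a function on the fibre. The nonzero components of the warped metric
    and of its Christoffel symbols have this form, and the class is stable under partial
    derivatives: a base direction [i] replaces [A] by [alpha_i A'], a fibre direction differentiates
    [B]. *)
Definition sep A B y := A (linear_form alpha (lsubmx y)) * B (rsubmx y).

Lemma sep_curve_l A B i y t :
  (B (rsubmx y) \o* A) (t *: alpha 0 i + linear_form alpha (lsubmx y))
  = sep A B (t *: delta_mx 0 (lshift m i) + y).
Proof. by rewrite /sep lsubmx_dirl rsubmx_dirl linear_formD linear_form_delta. Qed.

Lemma sep_curve_r A B i y t :
  (A (linear_form alpha (lsubmx y)) \*o B) (t *: delta_mx 0 i + rsubmx y)
  = sep A B (t *: delta_mx 0 (rshift n i) + y).
Proof. by rewrite /sep lsubmx_dirr rsubmx_dirr. Qed.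

Lemma derivable_sep_l A B i y :
  derivable A (linear_form alpha (lsubmx y)) 1 ->
  derivable (sep A B) y (delta_mx 0 (lshift m i)).
Proof.
move=> /(derive_real_dir (alpha 0 i)) [dA _].
apply: (derivable_curve (sep_curve_l A B i y)).
by apply: derivableM; [exact: dA|exact: derivable_cst].
Qed.

Lemma partial_sep_l A B i y :
  derivable A (linear_form alpha (lsubmx y)) 1 ->
  partial (lshift m i) (sep A B) y = alpha 0 i * sep (derive1 A) B y.
Proof.
move=> /(derive_real_dir (alpha 0 i)) [dA AE].
rewrite /partial -(derive_curve (sep_curve_l A B i y)).
by rewrite (deriveMr _ dA) AE /sep mulrC mulrA.
Qed.

Lemma derivable_sep_r A B i y :
  derivable B (rsubmx y) (delta_mx 0 i) ->
  derivable (sep A B) y (delta_mx 0 (rshift n i)).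
Proof.
move=> dB; apply: (derivable_curve (sep_curve_r A B i y)).
by apply: derivableM; [exact: derivable_cst|exact: dB].
Qed.

Lemma partial_sep_r A B i y :
  derivable B (rsubmx y) (delta_mx 0 i) ->
  partial (rshift n i) (sep A B) y = sep A (partial i B) y.
Proof.
by move=> dB; rewrite /partial -(derive_curve (sep_curve_r A B i y)) deriveMl.
Qed.

Variables (I : set R) (W : set 'rV[R]_m).
Hypotheses (Io : open I) (oW : open W).

(** The image of a product chart when [W] is the image of the fibre chart. *)
Definition sep_dom : set 'rV[R]_(n + m) :=
  [set y | I (linear_form alpha (lsubmx y)) /\ W (rsubmx y)].

Lemma open_sep_dom : open sep_dom.
Proof.
apply: (@open_block _ _ _ (linear_form alpha @^-1` I) W) => //.
by apply: open_comp Io => y _; exact: linear_form_cont.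
Qed.

Lemma smooth_on_sep A B : smooth1 I A -> smooth_on W B ->
  smooth_on sep_dom (sep A B).
Proof.
move=> sA sB k; elim: k A B sA sB => [|k IH] A B sA sB.
  split=> // y [Iy Wy]; pose xi (x : 'rV[R]_(n + m)) := linear_form alpha (lsubmx x).
  have cxi : {for y, continuous xi}.
    apply: (@continuous_comp _ _ _ lsubmx (linear_form alpha)).
      exact: lsubmx_cont.
    exact: linear_form_cont.
  apply: (@continuousM _ _ (A \o xi) (B \o rsubmx)).
    apply: continuous_comp => //; apply: derivable1_cont.
    exact: (smooth1_derivable sA).
  apply: continuous_comp; first exact: rsubmx_cont.
  exact: smooth_on_cont sB Wy.
split; first exact: Ck_cont (IH A B sA sB).
move=> i; case: (split_ordP i) => j ->.
- split=> [y [Iy Wy]|].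
    by apply: derivable_sep_l; exact: (smooth1_derivable sA).
  (* The constant [alpha_j] is absorbed into the first factor, so that the derivative is again a
     [sep] and the induction hypothesis applies. *)
  apply: (Ck_eq open_sep_dom (F := sep (fun t => cst (alpha 0 j) t * derive1 A t) B)).
    move=> y /set_mem [Iy Wy]; rewrite partial_sep_l ?/sep ?mulrA //.
    exact: (smooth1_derivable sA).
  apply: IH => //; apply: smooth1M => //; first exact: smooth1_cst.
  exact: smooth1_derive.
- split=> [y [Iy Wy]|].
    by apply: derivable_sep_r; exact: smooth_on_derivable sB Wy.
  apply: (Ck_eq open_sep_dom (F := sep A (partial j B))).
    move=> y /set_mem [Iy Wy]; rewrite partial_sep_r //.
    exact: smooth_on_derivable sB Wy.
  by apply: IH => //; exact: smooth_on_partial.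
Qed.

End ProductCoordinates.

(** * The product manifold *)

Lemma smooth_on_sub {R : realType} {d} (U U' : set 'rV[R]_d) F :
  U `<=` U' -> smooth_on U' F -> smooth_on U F.
Proof.
move=> UU' sF k; elim: k F sF => [|k IH] F sF.
  by split=> // y /UU'; exact: smooth_on_cont sF.
split=> [y /UU'|i]; first exact: smooth_on_cont sF.
split=> [y /UU' Uy|]; first exact: smooth_on_derivable sF Uy.
by apply: IH; exact: smooth_on_partial.
Qed.

Lemma smooth_on_rsubmx {R : realType} {n m} (U : set 'rV[R]_(n + m))
    (W : set 'rV[R]_m) B :
  open W -> U `<=` rsubmx @^-1` W -> smooth_on W B ->
  smooth_on U (fun y => B (rsubmx y)).
Proof.
(* With the zero form, the whole line for [I] and first factor 1, a function on the fibre is a [sep]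
   without any condition on the base point. *)
move=> oW UW sB; pose zero : 'rV[R]_n := 0.
have s := smooth_on_sep zero openT oW (@smooth1_cst R setT 1) sB.
have -> : (fun y => B (rsubmx y)) = sep zero (cst 1) B.
  by apply/funext => y; rewrite /sep /cst mul1r.
by apply: smooth_on_sub s => y /UW Wy; split.
Qed.

Section CoordRep.
Context {R : realType} {d : nat} (A : atlas R d).
Hypothesis hA : smooth_manifold A.

Lemma chart_inj i (p q : pts A) :
  dom i p -> dom i q -> chart i p = chart i q -> p = q.
Proof. by move: hA => [_ _ _ /(_ i) [_ + _ _] _]; apply. Qed.

Lemma chart_cont i (p : pts A) : dom i p -> {for p, continuous (chart i)}.
Proof. by move: hA => [_ _ _ /(_ i) [_ _ + _] _]; apply. Qed.

Lemma dom_open (i : idx A) : open (dom i).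
Proof. by move: hA => [_ _ _ /(_ i) [+ _ _] _]. Qed.

Lemma chart_open (i : idx A) W : open W -> W `<=` dom i -> open (chart i @` W).
Proof. by move: hA => [_ _ _ /(_ i) [_ _ _ +] _]; apply. Qed.

Lemma image_dom_open (i : idx A) : open (chart i @` dom i).
Proof. by apply: chart_open => //; exact: dom_open. Qed.

(** Injectivity of the chart leaves only one value for [xget] to choose. *)
Lemma coord_repE {V : zmodType} i (q : pts A -> V) p :
  dom i p -> coord_rep i q (chart i p) = q p.
Proof.
move=> ip; rewrite /coord_rep.
have /(xgetPex 0) [p' [ip' pp' <-]] :
  exists w, exists p', [/\ dom i p', chart i p' = chart i p & q p' = w].
  by exists (q p), p.
by rewrite (chart_inj ip' ip pp').
Qed.

Lemma coord_rep_im {V : zmodType} i (q : pts A -> V) (Q : 'rV[R]_d -> V) :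
  (forall p, dom i p -> q p = Q (chart i p)) ->
  {in chart i @` dom i, coord_rep i q =1 Q}.
Proof. by move=> qQ y /set_mem [p ip <-]; rewrite coord_repE // qQ. Qed.

End CoordRep.

Section ProductManifold.
Context {R : realType} {n m : nat} (U : set 'rV[R]_n) (F : atlas R m).
Hypotheses (oU : open U) (hF : smooth_manifold F).

Let B := euclidean_subset U.
Let C := product_atlas B F.

Lemma set_val_rV (u : 'rV[R]_n) (Uu : U u) : exists p : pts B, set_val p = u.
Proof. by exists (exist _ u (mem_set Uu)). Qed.

Lemma set_valU (p : pts B) : U (set_val p).
Proof. exact: set_valP. Qed.

Lemma set_val_cont : continuous (set_val : pts B -> 'rV[R]_n).
Proof. exact: (@initial_continuous (U : Type) _ set_val). Qed.

Lemma image_chart_product (i : idx C) (D : set (pts F)) :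
  chart i @` (setT `*` D : set (pts C)) =
  [set y | U (lsubmx y) /\ (chart i.2 @` D) (rsubmx y)].
Proof.
rewrite eqEsubset; split=> [_ [[p q] [_ /= Dq] <-]|y [/= Uy [q Dq qE]]] /=.
  by rewrite row_mxKl row_mxKr; split; [exact: set_valU|exists q].
have [p pE] := set_val_rV Uy; exists (p, q) => //.
by rewrite /= pE qE hsubmxK.
Qed.

Lemma image_dom_product (i : idx C) :
  chart i @` dom i = [set y | U (lsubmx y) /\ (chart i.2 @` dom i.2) (rsubmx y)].
Proof. exact: image_chart_product. Qed.

Lemma product_chart_inj (i : idx C) (p q : pts C) :
  dom i p -> dom i q -> chart i p = chart i q -> p = q.
Proof.
case: p q => [p1 p2] [q1 q2] [_ /= d1] [_ /= d2] /eq_row_mx [e1 e2].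
by congr pair; [exact: val_inj|exact: chart_inj hF _ _ _ d1 d2 e2].
Qed.

(** [coord_repE] presupposes a manifold, and this identity enters the proof that the product is one;
    injectivity of the product charts is enough here. *)
Lemma product_coord_repE {V : zmodType} (i : idx C) (q : pts C -> V) p :
  dom i p -> coord_rep i q (chart i p) = q p.
Proof.
move=> ip; rewrite /coord_rep.
have /(xgetPex 0) [p' [ip' pp' <-]] :
  exists w, exists p', [/\ dom i p', chart i p' = chart i p & q p' = w].
  by exists (q p), p.
by rewrite (product_chart_inj ip' ip pp').
Qed.

Lemma product_transition (i j : idx C) :
  {in chart i @` dom i, transition i j =1
     fun y => row_mx (lsubmx y) (transition i.2 j.2 (rsubmx y))}.
Proof.
move=> _ /set_mem [p ip <-]; rewrite /transition product_coord_repE //=.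
have [_ /= ip2] := ip.
by rewrite row_mxKl row_mxKr coord_repE.
Qed.

Lemma product_smooth_manifold : smooth_manifold C.
Proof.
have [hausF scF covF chF trF] := hF; split.
- apply: hausdorff_prod hausF; apply: hausdorff_set_type.
  exact: norm_hausdorff.
- apply: second_countable_prod scF; apply: second_countable_set_type.
  exact: second_countable_rV.
- by move=> [p q]; have [i iq] := covF q; exists (tt, i).
- move=> [[] i]; split=> /=.
  + rewrite openE => -[p q] [_ /= iq]; exists (setT, dom i) => //; split.
      exact: filterT.
    by apply: open_nbhs_nbhs; split=> //; exact: dom_open.
  + exact: (@product_chart_inj (tt, i)).
  + move=> [p q] [_ /= iq]; apply: row_mx_cvg.
      apply: (cvg_comp fst set_val); first exact: cvg_fst.
      exact: set_val_cont.
    apply: (cvg_comp snd (chart i)); first exact: cvg_snd.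
    exact: chart_cont.
  + move=> W oW Wdom; rewrite openE => _ [[p q] Wpq <-].
    have [_ /= iq] := Wdom _ Wpq.
    have [[P Q] [/= pP qQ] PQW] := open_nbhs_nbhs (conj oW Wpq).
    move: pP; rewrite nbhsE => -[_ [[P' oP' <-] /= P'p] PP].
    move: qQ; rewrite nbhsE => -[Q' [oQ' Q'q] QQ].
    have oQi : open (Q' `&` dom i) by apply: openI => //; exact: dom_open.
    (* The chart image of a box around [(p, q)]: the base chart is an inclusion, so the trace of
       [P'] has image [P'] intersected with [U], while the fibre chart is an open map. *)
    have o := open_block (openI oP' oU) (chart_open hF oQi (@subIsetr _ _ _)).
    apply: filterS (open_nbhs_nbhs (conj o _)); last first.
      rewrite /= row_mxKl row_mxKr; split; first by split=> //; exact: set_valU.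
      by exists q.
    move=> y [/= [P'y Uy] [q' [Q'q' iq'] q'E]].
    have [p' p'E] := set_val_rV Uy; exists (p', q').
      by apply: PQW; split; [apply: PP; rewrite /= p'E|exact: QQ].
    by rewrite /= p'E q'E hsubmxK.
- move=> i j b.
  have domE : dom i `&` dom j = (setT `*` (dom i.2 `&` dom j.2) : set (pts C)).
    by rewrite eqEsubset; split=> [[p q] /= [[_ ?] [_ ?]]|[p q] /= [_ [? ?]]].
  have oij : open (dom i.2 `&` dom j.2) by apply: openI; exact: dom_open.
  have oim := chart_open hF oij (@subIsetl _ _ _).
  rewrite domE image_chart_product.
  have oD := open_block oU oim.
  have sub : [set y : 'rV[R]_(n + m) | U (lsubmx y) /\
      (chart i.2 @` (dom i.2 `&` dom j.2)) (rsubmx y)] `<=` chart i @` dom i.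
    rewrite image_dom_product => y [Uy [q [iq _] qE]]; split=> //.
    by exists q.
  case: (split_ordP b) => b' ->.
  + apply: (smooth_on_eq oD (F := fun y => lsubmx y 0 b')).
      by move=> y /set_mem/sub/mem_set/product_transition ->; rewrite row_mxEl.
    exact: smooth_on_lcoord.
  + apply: (smooth_on_eq oD (F := fun y => transition i.2 j.2 (rsubmx y) 0 b')).
      by move=> y /set_mem/sub/mem_set/product_transition ->; rewrite row_mxEr.
    apply: (smooth_on_rsubmx (B := fun w => transition i.2 j.2 w 0 b') oim).
      by move=> y [].
    exact: trF.
Qed.

End ProductManifold.

(** * Curvature of the warped metric *)

Section LogDerivatives.
Context {R : realType}.
Implicit Types (f g : R -> R) (t p q : R).

(** Derivatives are carried in logarithmic form, as in the given equations [f'/f = x]; logarithmic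
    derivatives add under products. *)
Lemma is_derive_logM f g t p q :
  is_derive t 1 f (p * f t) -> is_derive t 1 g (q * g t) ->
  is_derive t 1 (fun s => f s * g s) ((p + q) * (f t * g t)).
Proof.
move=> df dg; apply: (is_derive_eq (is_deriveM df dg)).
by rewrite -[_ *: _]/(_ * _) -[X in _ + X]/(_ * _); ring.
Qed.

Lemma is_derive_log_sqr f t p : is_derive t 1 f (p * f t) ->
  is_derive t 1 (fun s => f s ^+ 2) ((2 * p) * f t ^+ 2).
Proof.
move=> df; have := is_derive_logM df df; under eq_fun do rewrite -expr2.
by move=> d; apply: (is_derive_eq d); ring.
Qed.

Lemma is_derive_logV f t p : f t != 0 -> is_derive t 1 f (p * f t) ->
  is_derive t 1 (fun s => (f s)^-1) (- p * (f t)^-1).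
Proof.
move=> f0 df; apply: DeriveDef; first by apply: derivableV => //; case: df.
rewrite deriveV //.
by rewrite derive_val -[_ *: _]/(_ * _); field.
Qed.

End LogDerivatives.

(** * Contractions of the Christoffel symbols of a conformally flat metric *)

Section Delta.
Context {R : realType} {n : nat}.

Lemma sum_deltar (X : 'I_n -> R) i : \sum_(s < n) X s * (s == i)%:R = X i.
Proof.
rewrite (bigD1 i) //= eqxx mulr1 big1 ?addr0 // => s /negPf ->.
by rewrite mulr0.
Qed.

Lemma sum_deltal (X : 'I_n -> R) i : \sum_(s < n) X s * (i == s)%:R = X i.
Proof. by under eq_bigr do rewrite eq_sym; exact: sum_deltar. Qed.

Lemma sum_const (x : R) : \sum_(s < n) x = n%:R * x.
Proof. by rewrite sumr_const card_ord mulr_natl. Qed.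

Variables (eps alpha : 'rV[R]_n) (e0 : R).
Hypothesis eps2 : forall i, eps 0 i * eps 0 i = 1.
Hypothesis halpha : \sum_(i < n) eps 0 i * alpha 0 i ^+ 2 = e0.

(* The Christoffel symbols of the metric phi^-2 eps are [P * conf_chr], with
   [P = phi' / phi]. *)
Definition conf_chr (l i j : 'I_n) : R :=
  - (alpha 0 i * (j == l)%:R + alpha 0 j * (i == l)%:R
     - eps 0 l * eps 0 i * alpha 0 l * (i == j)%:R).

(** The other two terms cancel already for each single [s], because [eps_s ^ 2 = 1]. *)
Lemma conf_chr_diag s i : conf_chr s s i = - alpha 0 i.
Proof.
rewrite /conf_chr eqxx eps2 [s == i]eq_sym.
by case: (i == s); rewrite /=; ring.
Qed.

(** Since the gradient of a function of [xi] is a multiple of [alpha], this contraction occurs in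
    the Hessian; in the Ricci tensor it comes from both the divergence and the trace term. *)
Lemma conf_chr_alpha i j :
  \sum_(s < n) alpha 0 s * conf_chr s i j =
  - (2 * alpha 0 i * alpha 0 j - e0 * eps 0 i * (i == j)%:R).
Proof.
have -> : \sum_(s < n) alpha 0 s * conf_chr s i j =
  - (\sum_(s < n) (alpha 0 i * alpha 0 s) * (j == s)%:R
     + \sum_(s < n) (alpha 0 j * alpha 0 s) * (i == s)%:R
     - (eps 0 i * (i == j)%:R) * \sum_(s < n) eps 0 s * alpha 0 s ^+ 2).
  rewrite mulr_sumr -big_split -sumrB -sumrN /=; apply: eq_bigr => s _.
  by rewrite /conf_chr; ring.
by rewrite !sum_deltal halpha; ring.
Qed.

Lemma conf_chr_eps_alpha i j :
  \sum_(s < n) eps 0 s * alpha 0 s * conf_chr j s i = - e0 * (i == j)%:R.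
Proof.
have -> : \sum_(s < n) eps 0 s * alpha 0 s * conf_chr j s i =
  - ((i == j)%:R * (\sum_(s < n) eps 0 s * alpha 0 s ^+ 2)
     + \sum_(s < n) (alpha 0 i * eps 0 s * alpha 0 s) * (s == j)%:R
     - \sum_(s < n) (eps 0 j * alpha 0 j * (eps 0 s * eps 0 s) * alpha 0 s)
         * (s == i)%:R).
  rewrite mulr_sumr -big_split -sumrB -sumrN /=; apply: eq_bigr => s _.
  by rewrite /conf_chr; ring.
by rewrite !sum_deltar halpha eps2; ring.
Qed.

Lemma conf_chr_sq i j :
  \sum_(s < n) \sum_(t < n) conf_chr s j t * conf_chr t s i =
  (n%:R + 2) * alpha 0 i * alpha 0 j - 2 * e0 * eps 0 i * (i == j)%:R.
Proof.
(* Only the first factor is expanded: its deltas collapse two of the sums over [t], and its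
   [alpha_t] turns the third into [conf_chr_alpha]. *)
have inner s : \sum_(t < n) conf_chr s j t * conf_chr t s i =
    alpha 0 j * alpha 0 i
    + (2 * alpha 0 s * alpha 0 i - e0 * eps 0 s * (s == i)%:R) * (j == s)%:R
    + eps 0 j * (eps 0 s * alpha 0 s * conf_chr j s i).
  have -> : \sum_(t < n) conf_chr s j t * conf_chr t s i =
    - (\sum_(t < n) (alpha 0 j * conf_chr t s i) * (t == s)%:R
       + (j == s)%:R * (\sum_(t < n) alpha 0 t * conf_chr t s i)
       - \sum_(t < n) (eps 0 s * eps 0 j * alpha 0 s * conf_chr t s i)
           * (j == t)%:R).
    rewrite mulr_sumr -big_split -sumrB -sumrN /=; apply: eq_bigr => t _.
    by rewrite [conf_chr s j t]/conf_chr; ring.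
  by rewrite sum_deltar sum_deltal conf_chr_diag conf_chr_alpha; ring.
rewrite (eq_bigr _ (fun s _ => inner s)) !big_split /= -[X in _ + X]mulr_sumr.
rewrite conf_chr_eps_alpha sum_deltal sum_const.
(* The contractions produce [eps_j] where the statement has [eps_i]; the two agree on the support of
   the delta. *)
by have [->|ij] := eqVneq i j; rewrite /=; ring.
Qed.

End Delta.

Lemma invmx_unique {R : comUnitRingType} {d} (M N : 'M[R]_d) :
  M *m N = 1%:M -> invmx M = N.
Proof.
move=> MN; have [uM _] := mulmx1_unit MN.
by rewrite -[N](mulKmx uM) MN mulmx1.
Qed.

Lemma christoffel_sym {R : realType} {d} (W : set 'rV[R]_d) G l i j w :
  open W -> (forall x, W x -> (G x)^T = G x) -> W w ->
  christoffel G l i j w = christoffel G l j i w.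
Proof.
move=> oW symG Ww; congr (_ * _); apply: eq_bigr => s _; congr (_ * _).
rewrite [X in X - _]addrC; congr (_ - _); apply: (partial_eq_on _ oW Ww).
by move=> x /set_mem Wx; rewrite -[in LHS](symG _ Wx) mxE.
Qed.

Section WarpedCurvature.
Context {R : realType} {n m : nat}.
Variables (eps alpha : 'rV[R]_n) (e0 : R) (I : set R) (W : set 'rV[R]_m).
Variables (GF : 'rV[R]_m -> 'M[R]_m) (G : 'rV[R]_(n + m) -> 'M[R]_(n + m)).
Variables (phi f P Q : R -> R).
Hypotheses (Io : open I) (oW : open W).
Hypothesis eps2 : forall i, eps 0 i * eps 0 i = 1.
Hypothesis halpha : \sum_(i < n) eps 0 i * alpha 0 i ^+ 2 = e0.
Hypothesis sGF : forall a b, smooth_on W (fun w => GF w a b).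
Hypothesis symGF : forall w, W w -> (GF w)^T = GF w.
Hypothesis unitGF : forall w, W w -> GF w \in unitmx.
Hypothesis phi0 : forall t, I t -> phi t != 0.
Hypothesis f0 : forall t, I t -> f t != 0.
Hypothesis dphi : forall t, I t -> is_derive t 1 phi (P t * phi t).
Hypothesis df : forall t, I t -> is_derive t 1 f (Q t * f t).
Hypothesis dP : forall t, I t -> derivable P t 1.
Hypothesis dQ : forall t, I t -> derivable Q t 1.

Let D := sep_dom alpha I W.
Let xi (y : 'rV[R]_(n + m)) := linear_form alpha (lsubmx y).

Hypothesis GE : forall y, D y ->
  G y = block_mx ((phi (xi y) ^+ 2)^-1 *: diag_mx eps) 0 0
                 (f (xi y) ^+ 2 *: GF (rsubmx y)).

Let oD : open D. Proof. exact: open_sep_dom. Qed.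

Local Notation lsh := (lshift m).
Local Notation rsh := (@rshift n m).

Lemma warped_inv y : D y -> invmx (G y) =
  block_mx (phi (xi y) ^+ 2 *: diag_mx eps) 0 0
           ((f (xi y) ^+ 2)^-1 *: invmx (GF (rsubmx y))).
Proof.
move=> Dy; have [Iy Wy] := Dy; apply: invmx_unique.
rewrite (GE Dy) mulmx_block !mulmx0 !mul0mx !addr0 !add0r scalar_mx_block.
rewrite -!scalemxAl -!scalemxAr !scalerA mulVf ?mulfV ?expf_neq0 ?f0 ?phi0 //.
rewrite !scale1r mulmxV ?unitGF //; congr block_mx.
by apply/matrixP => i j; rewrite mul_diag_mx !mxE mulrnAr eps2.
Qed.

Lemma partial_sep_log (A : R -> R) (B : 'rV[R]_m -> R) (a : R) i y :
  is_derive (xi y) 1 A (a * A (xi y)) ->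
  partial (lsh i) (sep alpha A B) y = alpha 0 i * a * sep alpha A B y.
Proof.
move=> [dA A'E]; rewrite partial_sep_l //.
by rewrite /sep derive1E A'E !mulrA.
Qed.

Let Gll i j : {in D, (fun y => G y (lsh i) (lsh j))
  =1 sep alpha (fun t => (phi t ^+ 2)^-1) (cst (diag_mx eps i j))}.
Proof. by move=> y /set_mem Dy; rewrite GE // block_mxEul mxE. Qed.

Let Grr a b : {in D, (fun y => G y (rsh a) (rsh b))
  =1 sep alpha (fun t => f t ^+ 2) (fun w => GF w a b)}.
Proof. by move=> y /set_mem Dy; rewrite GE // block_mxEdr mxE. Qed.

Let Glr i b : {in D, (fun y => G y (lsh i) (rsh b)) =1 cst 0}.
Proof. by move=> y /set_mem Dy; rewrite GE // block_mxEur mxE. Qed.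

Let Grl b i : {in D, (fun y => G y (rsh b) (lsh i)) =1 cst 0}.
Proof. by move=> y /set_mem Dy; rewrite GE // block_mxEdl mxE. Qed.

Lemma partial_Gll_l k i j y : D y ->
  partial (lsh k) (fun y => G y (lsh i) (lsh j)) y =
  - 2 * P (xi y) * alpha 0 k * (phi (xi y) ^+ 2)^-1 * (eps 0 i * (i == j)%:R).
Proof.
move=> Dy; have [Iy _] := Dy.
have d := is_derive_logV (f := fun s => phi s ^+ 2)
  (expf_neq0 2 (phi0 Iy)) (is_derive_log_sqr (dphi Iy)).
rewrite (partial_eq_on _ oD Dy (Gll i j)) (partial_sep_log _ _ d).
by rewrite /sep /cst mxE -mulr_natr; ring.
Qed.

Lemma partial_Gll_r k i j y : D y ->
  partial (rsh k) (fun y => G y (lsh i) (lsh j)) y = 0.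
Proof.
move=> Dy; rewrite (partial_eq_on _ oD Dy (Gll i j)).
exact: (partial_lsubmx_r
  (fun u => (phi (linear_form alpha u) ^+ 2)^-1 * diag_mx eps i j)).
Qed.

Lemma partial_Grr_l k a b y : D y ->
  partial (lsh k) (fun y => G y (rsh a) (rsh b)) y =
  2 * Q (xi y) * alpha 0 k * f (xi y) ^+ 2 * GF (rsubmx y) a b.
Proof.
move=> Dy; have [Iy _] := Dy.
rewrite (partial_eq_on _ oD Dy (Grr a b)).
by rewrite (partial_sep_log _ _ (is_derive_log_sqr (df Iy))) /sep; ring.
Qed.

Lemma partial_Grr_r k a b y : D y ->
  partial (rsh k) (fun y => G y (rsh a) (rsh b)) y =
  f (xi y) ^+ 2 * partial k (fun w => GF w a b) (rsubmx y).
Proof.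
move=> Dy; have [_ Wy] := Dy.
rewrite (partial_eq_on _ oD Dy (Grr a b)) partial_sep_r //.
exact: smooth_on_derivable (sGF a b) Wy.
Qed.

Lemma partial_Glr k i b y : D y -> partial k (fun y => G y (lsh i) (rsh b)) y = 0.
Proof.
by move=> Dy; rewrite (partial_eq_on _ oD Dy (Glr i b)) partial_constl.
Qed.

Lemma partial_Grl k b i y : D y -> partial k (fun y => G y (rsh b) (lsh i)) y = 0.
Proof.
by move=> Dy; rewrite (partial_eq_on _ oD Dy (Grl b i)) partial_constl.
Qed.

(** * Christoffel symbols of the warped metric *)

Local Notation Gam := (christoffel G).

(** The inverse metric is block diagonal, and diagonal on the base, so a single summand survives. *)
Lemma christoffel_l l i j y : D y -> Gam (lsh l) i j y =
  2^-1 * (phi (xi y) ^+ 2 * eps 0 l * (partial i (fun x => G x j (lsh l)) y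
    + partial j (fun x => G x i (lsh l)) y - partial (lsh l) (fun x => G x i j) y)).
Proof.
move=> Dy; rewrite /christoffel warped_inv // big_split_ord /=.
rewrite [X in _ + X]big1 ?addr0 => [|s _]; last by rewrite block_mxEur mxE mul0r.
congr (_ * _); rewrite (bigD1 l) //= big1 ?addr0 => [|s /negPf sl].
  by rewrite block_mxEul !mxE eqxx mulr1n.
by rewrite block_mxEul !mxE eq_sym sl mulr0n mulr0 mul0r.
Qed.

Lemma christoffel_r l i j y : D y -> Gam (rsh l) i j y =
  2^-1 * (f (xi y) ^+ 2)^-1 * \sum_(s < m) invmx (GF (rsubmx y)) l s *
   (partial i (fun x => G x j (rsh s)) y
    + partial j (fun x => G x i (rsh s)) y - partial (rsh s) (fun x => G x i j) y).
Proof.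
move=> Dy; rewrite /christoffel warped_inv // big_split_ord /=.
rewrite [X in X + _]big1 ?add0r => [|s _]; last by rewrite block_mxEdl mxE mul0r.
rewrite -mulrA; congr (_ * _); rewrite mulr_sumr; apply: eq_bigr => s _.
by rewrite block_mxEdr !mxE mulrA.
Qed.

Lemma christoffel_lll l i j y : D y ->
  Gam (lsh l) (lsh i) (lsh j) y = P (xi y) * conf_chr eps alpha l i j.
Proof.
move=> Dy; have [Iy _] := Dy.
rewrite christoffel_l // !partial_Gll_l // /conf_chr.
(* All signs next to a delta are moved to the index [l], so that [eps_l ^ 2] and [phi ^ 2 / phi ^ 2]
   can be isolated and replaced by 1. *)
have -> : eps 0 j * (j == l)%:R = eps 0 l * (j == l)%:R.
  by have [->//|_] := eqVneq; rewrite !mulr0.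
have -> : eps 0 i * (i == l)%:R = eps 0 l * (i == l)%:R.
  by have [->//|_] := eqVneq; rewrite !mulr0.
transitivity (- P (xi y) * (phi (xi y) ^+ 2 * (phi (xi y) ^+ 2)^-1) *
  (eps 0 l * eps 0 l * (alpha 0 i * (j == l)%:R + alpha 0 j * (i == l)%:R)
   - eps 0 l * eps 0 i * alpha 0 l * (i == j)%:R)); first by field; rewrite phi0.
by rewrite eps2 divff ?expf_neq0 ?phi0 //; ring.
Qed.

Lemma christoffel_llr l i b y : D y -> Gam (lsh l) (lsh i) (rsh b) y = 0.
Proof.
move=> Dy; rewrite christoffel_l // partial_Grl // partial_Gll_r // partial_Glr //.
by rewrite !addr0 subr0 !mulr0.
Qed.

Lemma christoffel_lrl l a j y : D y -> Gam (lsh l) (rsh a) (lsh j) y = 0.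
Proof.
move=> Dy; rewrite christoffel_l // !partial_Grl // partial_Gll_r //.
by rewrite !addr0 subr0 !mulr0.
Qed.

(** The classical term [- f grad f] times [g_F]: the base metric raises the index of [f' alpha_l] by
    [phi ^ 2 eps_l], and [f f' = Q f ^ 2]. *)
Lemma christoffel_lrr l a b y : D y -> Gam (lsh l) (rsh a) (rsh b) y =
  - (phi (xi y) ^+ 2 * f (xi y) ^+ 2 * Q (xi y)) *
  (eps 0 l * alpha 0 l * GF (rsubmx y) a b).
Proof.
move=> Dy; rewrite christoffel_l // !partial_Grl // partial_Grr_l //.
by field.
Qed.

Lemma christoffel_rll l i j y : D y -> Gam (rsh l) (lsh i) (lsh j) y = 0.
Proof.
move=> Dy; rewrite christoffel_r // big1 ?mulr0 // => s _.
by rewrite !partial_Glr // partial_Gll_r // !addr0 subr0 mulr0.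
Qed.

Let invGF_sum w a b : W w ->
  \sum_(s < m) invmx (GF w) a s * GF w b s = (a == b)%:R.
Proof.
move=> Ww; have := congr1 (fun M : 'M[R]_m => M a b) (mulVmx (unitGF Ww)).
rewrite !mxE => <-; apply: eq_bigr => s _; congr (_ * _).
by rewrite -[in LHS](symGF Ww) mxE.
Qed.

Lemma christoffel_rlr l i b y : D y ->
  Gam (rsh l) (lsh i) (rsh b) y = Q (xi y) * alpha 0 i * (l == b)%:R.
Proof.
(* The delta is expanded into the product of [g_F] with its inverse, so that both sides are sums
   over [s] and can be compared term by term. *)
move=> Dy; have [Iy Wy] := Dy; rewrite christoffel_r // -(invGF_sum l b Wy).
rewrite !mulr_sumr; apply: eq_bigr => s _.
rewrite partial_Grr_l // !partial_Glr //; field; exact: f0.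
Qed.

Lemma christoffel_rrl l a j y : D y ->
  Gam (rsh l) (rsh a) (lsh j) y = Q (xi y) * alpha 0 j * (l == a)%:R.
Proof.
move=> Dy; have [Iy Wy] := Dy; rewrite christoffel_r // -(invGF_sum l a Wy).
rewrite !mulr_sumr; apply: eq_bigr => s _.
rewrite partial_Grr_l // partial_Glr // partial_Grl //; field; exact: f0.
Qed.

(** The warping factor [f ^ 2] is constant along the fibre and cancels against its inverse. *)
Lemma christoffel_rrr l a b y : D y ->
  Gam (rsh l) (rsh a) (rsh b) y = christoffel GF l a b (rsubmx y).
Proof.
move=> Dy; have [Iy Wy] := Dy; rewrite christoffel_r // /christoffel !mulr_sumr.
apply: eq_bigr => s _; rewrite !partial_Grr_r //; field; exact: f0.
Qed.

(** * Partial derivatives of the Christoffel symbols *)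

Lemma partial_lll_l k l i j y : D y ->
  partial (lsh k) (Gam (lsh l) (lsh i) (lsh j)) y =
  alpha 0 k * derive1 P (xi y) * conf_chr eps alpha l i j.
Proof.
move=> Dy; have [Iy Wy] := Dy.
rewrite (partial_eq_on (G := sep alpha P (cst (conf_chr eps alpha l i j))) _ oD Dy).
  by rewrite partial_sep_l ?/sep ?mulrA //; exact: dP.
by move=> x /set_mem Dx; rewrite christoffel_lll.
Qed.

Lemma partial_lll_r k l i j y : D y ->
  partial (rsh k) (Gam (lsh l) (lsh i) (lsh j)) y = 0.
Proof.
move=> Dy; rewrite (partial_eq_on (G := fun x =>
  (fun u => P (linear_form alpha u) * conf_chr eps alpha l i j) (lsubmx x)) _ oD Dy).
  by apply: partial_constl => t; rewrite lsubmx_dirr.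
by move=> x /set_mem Dx; rewrite christoffel_lll.
Qed.

Lemma partial_lrr_l k l a b y : D y ->
  partial (lsh k) (Gam (lsh l) (rsh a) (rsh b)) y =
  - (phi (xi y) ^+ 2 * f (xi y) ^+ 2 *
     (derive1 Q (xi y) + 2 * P (xi y) * Q (xi y) + 2 * Q (xi y) ^+ 2)) *
  (eps 0 l * alpha 0 l * alpha 0 k) * GF (rsubmx y) a b.
Proof.
move=> Dy; have [Iy Wy] := Dy; pose A t := phi t ^+ 2 * f t ^+ 2 * Q t.
pose B (w : 'rV[R]_m) := - (eps 0 l * alpha 0 l * GF w a b).
(* The logarithmic derivative of [phi ^ 2 f ^ 2] is [2 P + 2 Q]. *)
have dA := is_derive_logM (is_derive_log_sqr (dphi Iy)) (is_derive_log_sqr (df Iy)).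
have dAQ := is_deriveM dA (derivableP (dQ Iy)).
rewrite (partial_eq_on (G := sep alpha A B) _ oD Dy).
  rewrite partial_sep_l; last by case: dAQ.
  rewrite /sep derive1E; have [_ ->] := dAQ.
  by rewrite -derive1E /B -[_ *: _]/(_ * _) -[X in _ + X]/(_ * _); ring.
by move=> x /set_mem Dx; rewrite christoffel_lrr // /sep /A /B; ring.
Qed.

Lemma partial_rrl_l k l a j y : D y ->
  partial (lsh k) (Gam (rsh l) (rsh a) (lsh j)) y =
  alpha 0 k * alpha 0 j * derive1 Q (xi y) * (l == a)%:R.
Proof.
move=> Dy; have [Iy Wy] := Dy.
rewrite (partial_eq_on (G := sep alpha Q (cst (alpha 0 j * (l == a)%:R))) _ oD Dy).
  by rewrite partial_sep_l ?/sep; [rewrite /cst; ring|exact: dQ].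
by move=> x /set_mem Dx; rewrite christoffel_rrl // /sep /cst mulrA.
Qed.

Lemma partial_rrl_r k l a j y : D y ->
  partial (rsh k) (Gam (rsh l) (rsh a) (lsh j)) y = 0.
Proof.
move=> Dy; rewrite (partial_eq_on (G := fun x =>
  (fun u => Q (linear_form alpha u) * alpha 0 j * (l == a)%:R) (lsubmx x)) _ oD Dy).
  by apply: partial_constl => t; rewrite lsubmx_dirr.
by move=> x /set_mem Dx; rewrite christoffel_rrl.
Qed.

Lemma partial_rlr_r k l i b y : D y ->
  partial (rsh k) (Gam (rsh l) (lsh i) (rsh b)) y = 0.
Proof.
move=> Dy; rewrite (partial_eq_on (G := fun x =>
  (fun u => Q (linear_form alpha u) * alpha 0 i * (l == b)%:R) (lsubmx x)) _ oD Dy).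
  by apply: partial_constl => t; rewrite lsubmx_dirr.
by move=> x /set_mem Dx; rewrite christoffel_rlr.
Qed.

Lemma partial_rrr_r k l a b y : D y ->
  partial (rsh k) (Gam (rsh l) (rsh a) (rsh b)) y =
  partial k (christoffel GF l a b) (rsubmx y).
Proof.
move=> Dy; rewrite (partial_eq_on (G := fun x =>
  christoffel GF l a b (rsubmx x)) _ oD Dy).
  exact: (partial_rsubmx_r (christoffel GF l a b)).
by move=> x /set_mem Dx; rewrite christoffel_rrr.
Qed.

Lemma partial_rrr_l k l a b y : D y ->
  partial (lsh k) (Gam (rsh l) (rsh a) (rsh b)) y = 0.
Proof.
move=> Dy; rewrite (partial_eq_on (G := fun x =>
  christoffel GF l a b (rsubmx x)) _ oD Dy).
  exact: (partial_rsubmx_l (christoffel GF l a b)).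
by move=> x /set_mem Dx; rewrite christoffel_rrr.
Qed.

Let partial_zero k (X : 'rV[R]_(n + m) -> R) y :
  (forall x, D x -> X x = 0) -> D y -> partial k X y = 0.
Proof.
move=> X0 Dy; rewrite (partial_eq_on (G := cst 0) _ oD Dy) ?partial_constl //.
by move=> x /set_mem /X0.
Qed.

Lemma partial_rll k l i j y : D y ->
  partial k (Gam (rsh l) (lsh i) (lsh j)) y = 0.
Proof. by apply: partial_zero => x; exact: christoffel_rll. Qed.

Lemma partial_llr k l i b y : D y ->
  partial k (Gam (lsh l) (lsh i) (rsh b)) y = 0.
Proof. by apply: partial_zero => x; exact: christoffel_llr. Qed.

Lemma partial_lrl k l a j y : D y ->
  partial k (Gam (lsh l) (rsh a) (lsh j)) y = 0.
Proof. by apply: partial_zero => x; exact: christoffel_lrl. Qed.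

(** * Ricci tensor of the warped metric, block by block *)

Let christoffelE := (christoffel_lll, christoffel_llr, christoffel_lrl,
  christoffel_lrr, christoffel_rll, christoffel_rlr, christoffel_rrl,
  christoffel_rrr).

Let partial_chrE := (partial_lll_l, partial_lll_r, partial_llr, partial_lrl,
  partial_lrr_l, partial_rll, partial_rlr_r, partial_rrl_l, partial_rrl_r,
  partial_rrr_l, partial_rrr_r).

(** The formula [Ric_B - (m / f) Hess f] of a warped product. In the contraction over [s], the base
    indices together give the Ricci tensor of the conformal metric ([Ls]), and each fibre index
    gives one [- Hess f / f] ([Rs]). *)
Lemma ricci_ll i j y : D y -> ricci G y (lsh i) (lsh j) =
  alpha 0 i * alpha 0 j *
    ((n%:R - 2) * (derive1 P (xi y) + P (xi y) ^+ 2)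
     - m%:R * (derive1 Q (xi y) + Q (xi y) ^+ 2 + 2 * P (xi y) * Q (xi y)))
  + e0 * eps 0 i * (i == j)%:R *
    (derive1 P (xi y) - (n%:R - 2) * P (xi y) ^+ 2 + m%:R * P (xi y) * Q (xi y)).
Proof.
move=> Dy; have [Iy Wy] := Dy; rewrite /ricci mxE big_split_ord /=.
set p := P (xi y); set q := Q (xi y); pose K := conf_chr eps alpha.
set p' := derive1 P (xi y); set q' := derive1 Q (xi y).
pose T := \sum_(t < n) alpha 0 t * K t i j.
have Ls s : partial (lsh s) (Gam (lsh s) (lsh i) (lsh j)) y
     - partial (lsh j) (Gam (lsh s) (lsh s) (lsh i)) y
     + \sum_(t < n + m) (Gam (lsh s) (lsh s) t y * Gam t (lsh i) (lsh j) y
        - Gam (lsh s) (lsh j) t y * Gam t (lsh s) (lsh i) y)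
   = p' * (alpha 0 s * K s i j) + (p' * alpha 0 j * alpha 0 i - p ^+ 2 * T)
     + - p ^+ 2 * \sum_(t < n) K s j t * K t s i.
  rewrite !partial_chrE // conf_chr_diag // big_split_ord /=.
  rewrite [X in _ + (_ + X) = _]big1 => [|t _]; last first.
    by rewrite !christoffelE // !mul0r subrr.
  have -> : \sum_(t < n) (Gam (lsh s) (lsh s) (lsh t) y * Gam (lsh t) (lsh i) (lsh j) y
        - Gam (lsh s) (lsh j) (lsh t) y * Gam (lsh t) (lsh s) (lsh i) y)
     = - p ^+ 2 * T - p ^+ 2 * \sum_(t < n) K s j t * K t s i.
    rewrite /T !mulr_sumr -sumrB; apply: eq_bigr => t _.
    by rewrite !christoffelE // conf_chr_diag // -/K -/p; ring.
  by rewrite -/K -/p'; ring.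
have Rs s : partial (rsh s) (Gam (rsh s) (lsh i) (lsh j)) y
     - partial (lsh j) (Gam (rsh s) (rsh s) (lsh i)) y
     + \sum_(t < n + m) (Gam (rsh s) (rsh s) t y * Gam t (lsh i) (lsh j) y
        - Gam (rsh s) (lsh j) t y * Gam t (rsh s) (lsh i) y)
   = - alpha 0 j * alpha 0 i * q' + q * p * T - q ^+ 2 * alpha 0 j * alpha 0 i.
  rewrite !partial_chrE // eqxx big_split_ord /=.
  have -> : \sum_(t < n) (Gam (rsh s) (rsh s) (lsh t) y * Gam (lsh t) (lsh i) (lsh j) y
        - Gam (rsh s) (lsh j) (lsh t) y * Gam (lsh t) (rsh s) (lsh i) y)
     = q * p * T.
    rewrite /T !mulr_sumr; apply: eq_bigr => t _.
    by rewrite !christoffelE // eqxx -/K -/p -/q /=; ring.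
  (* Each of the two mixed symbols contributes a delta; one stays in the summand while the other
     collapses the sum. *)
  have -> : \sum_(t < m) (Gam (rsh s) (rsh s) (rsh t) y * Gam (rsh t) (lsh i) (lsh j) y
        - Gam (rsh s) (lsh j) (rsh t) y * Gam (rsh t) (rsh s) (lsh i) y)
     = \sum_(t < m) (- q ^+ 2 * alpha 0 j * alpha 0 i * (s == t)%:R) * (s == t)%:R.
    apply: eq_bigr => t _; rewrite !christoffelE // -/q [t == s]eq_sym; ring.
  by rewrite sum_deltal eqxx -/q' /=; ring.
rewrite (eq_bigr _ (fun s _ => Ls s)) (eq_bigr _ (fun s _ => Rs s)).
rewrite !big_split /= -!mulr_sumr !sum_const.
rewrite (conf_chr_sq eps2 halpha) /T (conf_chr_alpha halpha).
ring.
Qed.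

(** What remains is [Q alpha_i] times the difference of the fibre symbols with lower indices [s, b]
    and [b, s], which vanishes by symmetry. *)
Lemma ricci_lr i b y : D y -> ricci G y (lsh i) (rsh b) = 0.
Proof.
move=> Dy; have [Iy Wy] := Dy; rewrite /ricci mxE big_split_ord /=.
rewrite big1 ?add0r => [|s _]; last first.
  rewrite !partial_chrE // subrr add0r big_split_ord /= !big1 ?addr0 // => t _;
  by rewrite !christoffelE // ?mulr0 ?mul0r subrr.
rewrite big1 // => s _; rewrite !partial_chrE // subrr add0r big_split_ord /=.
rewrite big1 ?add0r => [|t _]; last first.
  by rewrite !christoffelE // ?mulr0 ?mul0r subrr.
have -> : \sum_(t < m) (Gam (rsh s) (rsh s) (rsh t) y * Gam (rsh t) (lsh i) (rsh b) y
      - Gam (rsh s) (rsh b) (rsh t) y * Gam (rsh t) (rsh s) (lsh i) y)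
   = \sum_(t < m) (christoffel GF s s t (rsubmx y) * (Q (xi y) * alpha 0 i))
        * (t == b)%:R
     - \sum_(t < m) (christoffel GF s b t (rsubmx y) * (Q (xi y) * alpha 0 i))
        * (t == s)%:R.
  by rewrite -sumrB; apply: eq_bigr => t _; rewrite !christoffelE // !mulrA.
by rewrite !sum_deltar [X in _ - X * _](christoffel_sym _ _ _ oW symGF Wy) subrr.
Qed.

(** The defining expression of [ricci] is not visibly symmetric, so this block is computed
    separately; here the two remaining sums collapse to the same term. *)
Lemma ricci_rl b j y : D y -> ricci G y (rsh b) (lsh j) = 0.
Proof.
move=> Dy; have [Iy Wy] := Dy; rewrite /ricci mxE big_split_ord /=.
rewrite big1 ?add0r => [|s _]; last first.
  rewrite !partial_chrE // subrr add0r big_split_ord /= !big1 ?addr0 // => t _;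
  by rewrite !christoffelE // ?mulr0 ?mul0r subrr.
rewrite big1 // => s _; rewrite !partial_chrE // subrr add0r big_split_ord /=.
rewrite big1 ?add0r => [|t _]; last first.
  by rewrite !christoffelE // ?mulr0 ?mul0r subrr.
have -> : \sum_(t < m) (Gam (rsh s) (rsh s) (rsh t) y * Gam (rsh t) (rsh b) (lsh j) y
      - Gam (rsh s) (lsh j) (rsh t) y * Gam (rsh t) (rsh s) (rsh b) y)
   = \sum_(t < m) (christoffel GF s s t (rsubmx y) * (Q (xi y) * alpha 0 j))
        * (t == b)%:R
     - \sum_(t < m) ((Q (xi y) * alpha 0 j) * christoffel GF t s b (rsubmx y))
        * (s == t)%:R.
  by rewrite -sumrB; apply: eq_bigr => t _; rewrite !christoffelE //; ring.
by rewrite sum_deltar sum_deltal mulrC subrr.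
Qed.

(** The purely fibre terms reassemble into [Ric_F]. All others are proportional to [g_F], with the
    factor [e0 phi ^ 2], the squared length of [d xi] in the base metric. *)
Lemma ricci_rr b c y : D y -> ricci G y (rsh b) (rsh c) =
  ricci GF (rsubmx y) b c
  + e0 * phi (xi y) ^+ 2 * f (xi y) ^+ 2 * GF (rsubmx y) b c *
    ((n%:R - 2) * P (xi y) * Q (xi y) - derive1 Q (xi y) - m%:R * Q (xi y) ^+ 2).
Proof.
move=> Dy; have [Iy Wy] := Dy; rewrite /ricci !mxE big_split_ord /=.
set p := P (xi y); set q := Q (xi y); set q' := derive1 Q (xi y).
set w := rsubmx y; pose E := phi (xi y) ^+ 2 * f (xi y) ^+ 2 * GF w b c.
have GFcb : GF w c b = GF w b c by rewrite -[in LHS](symGF Wy) mxE.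
have Ls s : partial (lsh s) (Gam (lsh s) (rsh b) (rsh c)) y
     - partial (rsh c) (Gam (lsh s) (lsh s) (rsh b)) y
     + \sum_(t < n + m) (Gam (lsh s) (lsh s) t y * Gam t (rsh b) (rsh c) y
        - Gam (lsh s) (rsh c) t y * Gam t (lsh s) (rsh b) y)
   = E * ((q ^+ 2 - q' - 2 * p * q - 2 * q ^+ 2) * (eps 0 s * alpha 0 s ^+ 2)
          + p * q * e0).
  rewrite !partial_chrE // big_split_ord /=.
  have -> : \sum_(t < n) (Gam (lsh s) (lsh s) (lsh t) y * Gam (lsh t) (rsh b) (rsh c) y
        - Gam (lsh s) (rsh c) (lsh t) y * Gam (lsh t) (lsh s) (rsh b) y)
     = E * p * q * e0.
    (* [e0] is unfolded into its defining sum so that the two sides match for each [t]. *)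
    rewrite -halpha mulr_sumr; apply: eq_bigr => t _.
    by rewrite !christoffelE // conf_chr_diag // /E -/w -/p -/q; ring.
  have -> : \sum_(t < m) (Gam (lsh s) (lsh s) (rsh t) y * Gam (rsh t) (rsh b) (rsh c) y
        - Gam (lsh s) (rsh c) (rsh t) y * Gam (rsh t) (lsh s) (rsh b) y)
     = \sum_(t < m) (phi (xi y) ^+ 2 * f (xi y) ^+ 2 * q ^+ 2
          * (eps 0 s * alpha 0 s ^+ 2) * GF w c t) * (t == b)%:R.
    by apply: eq_bigr => t _; rewrite !christoffelE // -/w -/q; ring.
  by rewrite sum_deltar GFcb /E -/w -/p -/q -/q'; ring.
have Rs s : partial (rsh s) (Gam (rsh s) (rsh b) (rsh c)) y
     - partial (rsh c) (Gam (rsh s) (rsh s) (rsh b)) y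
     + \sum_(t < n + m) (Gam (rsh s) (rsh s) t y * Gam t (rsh b) (rsh c) y
        - Gam (rsh s) (rsh c) t y * Gam t (rsh s) (rsh b) y)
   = (partial s (christoffel GF s b c) w - partial c (christoffel GF s s b) w
      + \sum_(t < m) (christoffel GF s s t w * christoffel GF t b c w
        - christoffel GF s c t w * christoffel GF t s b w))
     + (- q ^+ 2 * E * e0 + (phi (xi y) ^+ 2 * f (xi y) ^+ 2 * q ^+ 2 * e0 * GF w s b)
           * (s == c)%:R).
  rewrite !partial_chrE // big_split_ord /=.
  have -> : \sum_(t < n) (Gam (rsh s) (rsh s) (lsh t) y * Gam (lsh t) (rsh b) (rsh c) y
        - Gam (rsh s) (rsh c) (lsh t) y * Gam (lsh t) (rsh s) (rsh b) y)
     = - q ^+ 2 * E * e0 + (phi (xi y) ^+ 2 * f (xi y) ^+ 2 * q ^+ 2 * e0 * GF w s b)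
           * (s == c)%:R.
    rewrite -halpha !mulr_sumr !mulr_suml -big_split; apply: eq_bigr => t _.
    by rewrite !christoffelE // eqxx /E -/w -/q /=; ring.
  rewrite (eq_bigr (fun t => christoffel GF s s t w * christoffel GF t b c w
        - christoffel GF s c t w * christoffel GF t s b w)) => [|t _]; last first.
    by rewrite !christoffelE.
  by rewrite -/w addrCA addrC.
rewrite (eq_bigr _ (fun s _ => Ls s)) -mulr_sumr big_split /= -mulr_sumr.
rewrite halpha sum_const (eq_bigr _ (fun s _ => Rs s)) big_split /=.
(* The sum giving [Ric_F] is generalized to a variable, an atom for [ring]. *)
set Ric := \sum_(s < m) (_ - _ + _).
rewrite big_split /= sum_const sum_deltar GFcb; move: Ric => Ric.
by rewrite /E; ring.
Qed.

(** * Hessian of a function of [xi], with [S = H' / H] *)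

Variables (H S : R -> R).
Hypothesis dH : forall t, I t -> is_derive t 1 H (S t * H t).
Hypothesis dS : forall t, I t -> derivable S t 1.
Variable q : 'rV[R]_(n + m) -> R.
Hypothesis qE : {in D, q =1 fun y => H (xi y)}.

Let partial_q_l i : {in D, partial (lsh i) q =1
  sep alpha (fun t => S t * H t) (cst (alpha 0 i))}.
Proof.
move=> y /set_mem Dy; have [Iy _] := Dy.
rewrite (partial_eq_on (G := sep alpha H (cst 1)) _ oD Dy).
  by rewrite (partial_sep_log _ _ (dH Iy)) /sep /cst; ring.
by move=> x xD; rewrite qE // /sep mulr1.
Qed.

Let partial_q_r b : {in D, partial (rsh b) q =1 cst 0}.
Proof.
move=> y /set_mem Dy; rewrite (partial_eq_on _ oD Dy qE).
by apply: partial_constl => t; rewrite /xi lsubmx_dirr.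
Qed.

Lemma hessian_ll i j y : D y -> hessian G q y (lsh i) (lsh j) =
  H (xi y) * (alpha 0 i * alpha 0 j *
    (derive1 S (xi y) + S (xi y) ^+ 2 + 2 * P (xi y) * S (xi y))
    - e0 * eps 0 i * (i == j)%:R * (P (xi y) * S (xi y))).
Proof.
move=> Dy; have [Iy Wy] := Dy; rewrite /hessian mxE big_split_ord /=.
rewrite (partial_eq_on _ oD Dy (partial_q_l j)).
have dSH := is_deriveM (derivableP (dS Iy)) (dH Iy).
rewrite partial_sep_l; last by case: dSH.
have SH' : derive1 (fun t => S t * H t) (xi y)
    = (derive1 S (xi y) + S (xi y) ^+ 2) * H (xi y).
  rewrite derive1E; have [_ ->] := dSH.
  by rewrite -derive1E -[_ *: _]/(_ * _) -[X in _ + X]/(_ * _); ring.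
rewrite /sep -/(xi y) SH' /cst [X in _ - (_ + X)]big1 => [|s _]; last first.
  by rewrite christoffelE // mul0r.
have -> : \sum_(s < n) Gam (lsh s) (lsh i) (lsh j) y * partial (lsh s) q y
    = P (xi y) * S (xi y) * H (xi y) *
      \sum_(s < n) alpha 0 s * conf_chr eps alpha s i j.
  rewrite mulr_sumr; apply: eq_bigr => s _.
  by rewrite christoffelE // partial_q_l ?inE // /sep /cst -/(xi y); ring.
by rewrite (conf_chr_alpha halpha); ring.
Qed.

(** The second derivatives vanish along the fibre; only the symbols [christoffel_lrr] contribute. *)
Lemma hessian_rr b c y : D y -> hessian G q y (rsh b) (rsh c) =
  H (xi y) * (e0 * phi (xi y) ^+ 2 * f (xi y) ^+ 2 * Q (xi y) * S (xi y))
  * GF (rsubmx y) b c.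
Proof.
move=> Dy; have [Iy Wy] := Dy; rewrite /hessian mxE big_split_ord /=.
rewrite (partial_eq_on _ oD Dy (partial_q_r c)) partial_constl // sub0r.
rewrite [X in _ + X]big1 => [|s _]; last by rewrite partial_q_r ?inE // mulr0.
rewrite addr0 -halpha !(mulr_suml, mulr_sumr) -sumrN; apply: eq_bigr => s _.
by rewrite !christoffelE // partial_q_l ?inE // /sep /cst -/(xi y); ring.
Qed.

Lemma hessian_lr i b y : D y -> hessian G q y (lsh i) (rsh b) = 0.
Proof.
move=> Dy; have [Iy Wy] := Dy; rewrite /hessian mxE big_split_ord /=.
rewrite (partial_eq_on _ oD Dy (partial_q_r b)) partial_constl // sub0r.
rewrite !big1 ?addr0 ?oppr0 // => s _.
  by rewrite partial_q_r ?inE // mulr0.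
by rewrite christoffelE // mul0r.
Qed.

Lemma hessian_rl b j y : D y -> hessian G q y (rsh b) (lsh j) = 0.
Proof.
move=> Dy; have [Iy Wy] := Dy; rewrite /hessian mxE big_split_ord /=.
rewrite (partial_eq_on _ oD Dy (partial_q_l j)) partial_constl => [|t]; last first.
  by rewrite /sep lsubmx_dirr.
rewrite sub0r !big1 ?addr0 ?oppr0 // => s _.
  by rewrite partial_q_r ?inE // mulr0.
by rewrite christoffelE // mul0r.
Qed.

End WarpedCurvature.

(** * The warped product metric *)

Lemma block_diag_unitmx {R : comUnitRingType} {n m} (M : 'M[R]_n) (N : 'M[R]_m) :
  M \in unitmx -> N \in unitmx -> block_mx M 0 0 N \in unitmx.
Proof. by rewrite !unitmxE det_ublock unitrM => -> ->. Qed.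

Section WarpedProduct.
Context {R : realType} {n m : nat}.
Variables (eps alpha : 'rV[R]_n) (I : set R) (phi f : R -> R).
Variables (F : atlas R m) (gF : tensor2 F).
Hypotheses (Io : open I) (hF : semi_riemannian gF).
Hypothesis heps : forall i, eps 0 i = 1 \/ eps 0 i = -1.
Hypothesis phi0 : forall t, I t -> phi t != 0.
Hypothesis f0 : forall t, I t -> f t != 0.
Hypothesis sphi : smooth1 I (fun t => (phi t ^+ 2)^-1).
Hypothesis sf : smooth1 I (fun t => f t ^+ 2).

Let U := [set y : 'rV[R]_n | I (linear_form alpha y)].
Let B := euclidean_subset U.
Let xi := fun p : pts B => linear_form alpha (set_val p).
Let gbar := conformal_metric eps (fun p => phi (xi p)).
Let gtilde := warped_metric gbar gF (fun p => f (xi p)).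
Let C := product_atlas B F.

Let oU : open U.
Proof. by apply: open_comp Io => y _; exact: linear_form_cont. Qed.

Let mF : smooth_manifold F. Proof. by case: hF. Qed.

Let mC : smooth_manifold C. Proof. exact: product_smooth_manifold. Qed.

Let xiI (p : pts B) : I (xi p). Proof. exact: (set_valU p). Qed.

Lemma eps_sq i : eps 0 i * eps 0 i = 1.
Proof. by case: (heps i) => ->; rewrite ?mulr1 // mulrNN mulr1. Qed.

Lemma image_dom_sep (i : idx C) :
  chart i @` dom i = sep_dom alpha I (chart i.2 @` dom i.2).
Proof. exact: image_dom_product. Qed.

Lemma warped_metric_rep (i : idx C) :
  {in chart i @` dom i, coord_rep i (gtilde i) =1 fun y =>
    block_mx ((phi (linear_form alpha (lsubmx y)) ^+ 2)^-1 *: diag_mx eps) 0 0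
      (f (linear_form alpha (lsubmx y)) ^+ 2 *: coord_rep i.2 (gF i.2) (rsubmx y))}.
Proof.
apply: (coord_rep_im mC) => p [_ ip2].
by rewrite /= row_mxKl row_mxKr (coord_repE mF).
Qed.

Lemma smooth_function_xi (h : R -> R) : smooth1 I h ->
  smooth_function (fun p : pts C => h (xi p.1)).
Proof.
move=> sh i; have oi := image_dom_open mF (i := i.2).
have := smooth_on_sep alpha Io oi sh (@smooth_on_cst _ _ _ 1).
rewrite -image_dom_sep; apply: smooth_on_eq; first exact: (image_dom_open mC).
move=> y yi; apply/esym; move: y yi; apply: (coord_rep_im mC) => p _.
by rewrite /sep /cst mulr1 /= row_mxKl.
Qed.

(** The base has a single chart, so a change of chart acts on the fibre coordinates alone. *)
Lemma warped_jacobian (i j : idx C) p : dom i p ->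
  transition_jacobian i j p = block_mx 1%:M 0 0 (transition_jacobian i.2 j.2 p.2).
Proof.
move=> ip; have [_ ip2] := ip; have oi := image_dom_open mC (i := i).
have yi : (chart i @` dom i) (chart i p) by exists p.
have tr b := partial_eq_on (F := fun y => transition i j y 0 b)
  (G := fun y => row_mx (lsubmx y) (transition i.2 j.2 (rsubmx y)) 0 b) _ oi yi.
apply/matrixP => a b; rewrite mxE tr => [|y yd]; last first.
  by rewrite (product_transition mF).
case: (split_ordP b) => b' ->; [rewrite [X in partial _ X](_ : _ =
    fun y => (fun u : 'rV[R]_n => u 0 b') (lsubmx y))
  |rewrite [X in partial _ X](_ : _ =
    fun y => (fun u => transition i.2 j.2 u 0 b') (rsubmx y))].
- case: (split_ordP a) => a' ->.
    rewrite (partial_lsubmx_l (fun u : 'rV[R]_n => u 0 b')).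
    by rewrite block_mxEul mxE; have [_ ->] := partial_coord a' b' (lsubmx (chart i p)).
  by rewrite (partial_lsubmx_r (fun u : 'rV[R]_n => u 0 b')) block_mxEdl mxE.
- by apply/funext => y; rewrite row_mxEl.
- case: (split_ordP a) => a' ->.
    rewrite (partial_rsubmx_l (fun u => transition i.2 j.2 u 0 b')).
    by rewrite block_mxEur mxE.
  rewrite (partial_rsubmx_r (fun u => transition i.2 j.2 u 0 b')).
  by rewrite block_mxEdr mxE /= row_mxKr.
- by apply/funext => y; rewrite row_mxEr.
Qed.

Lemma warped_semi_riemannian : semi_riemannian gtilde.
Proof.
have [_ sgF trF symF [eta eta1 etaP]] := hF; split => //.
- move=> i a b; have oi := image_dom_open mF (i := i.2).
  have oC := image_dom_open mC (i := i).
  (* Each entry of the metric is a [sep], with factor 0 in the mixed blocks. *)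
  have sm A W : smooth1 I A -> smooth_on (chart i.2 @` dom i.2) W ->
      {in chart i @` dom i, sep alpha A W =1 fun y => coord_rep i (gtilde i) y a b} ->
      smooth_on (chart i @` dom i) (fun y => coord_rep i (gtilde i) y a b).
    move=> sA sW AW; apply: (smooth_on_eq oC AW).
    by rewrite image_dom_sep; exact: smooth_on_sep.
  case: (split_ordP a) => a' aE; case: (split_ordP b) => b' bE; subst a b.
  + apply: sm sphi (@smooth_on_cst _ _ _ (diag_mx eps a' b')) _ => y yi.
    by rewrite warped_metric_rep // block_mxEul [RHS]mxE.
  + apply: sm (@smooth1_cst _ _ 0) (@smooth_on_cst _ _ _ 0) _ => y yi.
    by rewrite warped_metric_rep // block_mxEur mxE /sep mul0r.
  + apply: sm (@smooth1_cst _ _ 0) (@smooth_on_cst _ _ _ 0) _ => y yi.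
    by rewrite warped_metric_rep // block_mxEdl mxE /sep mul0r.
  + apply: sm sf (sgF i.2 a' b') _ => y yi.
    by rewrite warped_metric_rep // block_mxEdr [RHS]mxE.
- move=> i j p ip jp; rewrite warped_jacobian // /gtilde /warped_metric.
  have [_ ip2] := ip; have [_ jp2] := jp.
  rewrite tr_block_mx !mulmx_block !trmx0 trmx1 !mulmx0 !mul0mx !addr0 !add0r.
  by rewrite !mulmx1 !mul1mx -scalemxAr -scalemxAl -(trF _ _ _ ip2 jp2) !mul0mx.
- move=> i p [_ ip2]; have [sy un] := symF i.2 p.2 ip2; split.
    rewrite /gtilde /warped_metric /gbar /conformal_metric.
    by rewrite tr_block_mx !linearZ /= tr_diag_mx sy !trmx0.
  apply: block_diag_unitmx; rewrite unitmxZ ?unitfE ?invr_eq0 ?expf_neq0 //.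
  - rewrite unitmxE det_diag unitfE; apply/prodf_neq0 => s _.
    by case: (heps s) => ->; rewrite ?oppr_eq0 oner_neq0.
  - exact: phi0.
  - exact: f0.
(* An orthonormal frame: the coordinate fields of the base scaled by [phi], and a frame of [g_F]
   scaled by [1 / f]. The signs are those of the two factors, hence the same at every point. *)
- exists (row_mx eps eta) => [a|i p [_ ip2]].
    by case: (split_ordP a) => a' ->; rewrite ?row_mxEl ?row_mxEr.
  have [P uP PE] := etaP i.2 p.2 ip2.
  exists (block_mx (phi (xi p.1))%:M 0 0 ((f (xi p.1))^-1 *: P)).
    apply: block_diag_unitmx; last by rewrite unitmxZ ?unitfE ?invr_eq0 ?f0.
    by rewrite -scalemx1 unitmxZ ?unitmx1 // unitfE phi0.
  rewrite /gtilde /warped_metric /gbar /conformal_metric tr_block_mx !mulmx_block.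
  rewrite !trmx0 !mulmx0 !mul0mx !addr0 !add0r diag_mx_row tr_scalar_mx.
  rewrite [(_ *: P)^T]linearZ /= mul_mx_scalar mul_scalar_mx !scalerA.
  rewrite !mul0mx -!scalemxAl -!scalemxAr !scalerA -scalemxAl PE.
  rewrite -!expr2 divff ?expf_neq0 ?phi0 // scale1r.
  by rewrite scalerA exprVn mulVf ?expf_neq0 ?f0 // scale1r.
Qed.

End WarpedProduct.

Theorem theorem2p6 (R : realType) (n m r : nat)
  (hn : (3 <= n)%N) (hm : (1 <= m)%N) (hr : (1 <= r)%N)
  (eps alpha : 'rV[R]_n)
  (heps : forall i, eps 0 i = 1 \/ eps 0 i = -1)
  (i0 : 'I_n)
  (halpha : \sum_(i < n) eps 0 i * alpha 0 i ^+ 2 = eps 0 i0)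
  (k c a b : R) (hk : 0 < k) (hc : 0 < c)
  (ha : a = (n%:R - 2) * k - m%:R)
  (hb : b = m%:R * (2 * k + 1) - (n%:R - 2) * k ^+ 2)
  (den v : R -> R)
  (hden : forall t, den t = r%:R * (r%:R - 1) * t ^+ 2
                            - 2 * r%:R * (k + a) * t + a ^+ 2 - b)
  (hv : forall t, v t = r%:R * (a - r%:R * t) / den t)
  (I : set R) (hIo : open I) (hI : is_interval I)
  (x z : R -> R)
  (hz : forall j t, I t -> derivable (derive1n j z) t 1)
  (hznc : exists s t, [/\ I s, I t & z s != z t])
  (J : set R) (hJ : is_interval J)
  (hJden : forall t, J t -> den t != 0)
  (hzJ : forall t, I t -> J (z t))
  (V : R -> R)
  (hVc : {within J, continuous V})
  (hV : forall t : R, interior J t -> is_derive t 1 V (v t))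
  (hsys1 : forall t, I t ->
     v (z t) * derive1 z t - c * (a - r%:R * z t) * expR (V (z t)) = 0)
  (hsys2 : forall t, I t -> x t = c * expR (V (z t)))
  (f phi h : R -> R)
  (hf0 : forall t, I t -> 0 < f t)
  (hphi0 : forall t, I t -> phi t != 0)
  (hh0 : forall t, I t -> h t != 0)
  (hf : forall t, I t -> derivable f t 1 /\ derive1 f t / f t = x t)
  (hphi : forall t, I t -> derivable phi t 1 /\ derive1 phi t / phi t = k * x t)
  (hh : forall t, I t -> derivable h t 1 /\ derive1 h t / h t = x t * z t)
  (F : atlas R m) (gF : tensor2 F)
  (hF : semi_riemannian gF) (hFric : ricci_flat gF) :
  let U := [set y : 'rV[R]_n | I (linear_form alpha y)] in
  let B := euclidean_subset U in
  let xi := fun p : pts B => linear_form alpha (set_val p) in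
  let gbar := conformal_metric eps (fun p => phi (xi p)) in
  let gtilde := warped_metric gbar gF (fun p => f (xi p)) in
  quasi_einstein gtilde (fun p => h (xi p.1)) r%:R 0.
Proof.
have oU : open [set y : 'rV[R]_n | I (linear_form alpha y)].
  by apply: open_comp hIo => y _; exact: linear_form_cont.
have r0 : 0 < r%:R :> R by rewrite ltr0n.
have sz : smooth1 I z by exact: derivable_upto_iter.
have cden : continuous den.
  rewrite (_ : den = horner ((r%:R * (r%:R - 1)) *: 'X^2
      - (2 * r%:R * (k + a)) *: 'X + (a ^+ 2 - b)%:P)).
    exact: continuous_horner.
  by apply/funext => t;
     rewrite !(hornerD, hornerN, hornerZ, hornerXn, hornerX, hornerC) hden; ring.
(* [X] agrees with [x] on [I] and has the explicit form to which the lemmas on the system apply. *)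
pose X t := c * expR (V (z t)).
have z' t : I t -> derive1 z t = X t * den (z t) / r%:R.
  exact: (system_derive_z r0 hc hIo hI sz hznc hJden hzJ cden hv hVc hsys1).
have dX t : I t -> is_derive t 1 X ((a - r%:R * z t) * X t ^+ 2).
  exact: (system_derive_x r0 hc hIo hI hJ sz hznc hJden hzJ cden hv hVc hV hsys1).
have dz t : I t -> derivable z t 1 by exact: smooth1_derivable.
have sX : smooth1 I X.
  apply: (smooth1_bernoulli hIo _ dX); apply: (smooth1D hIo) => /=.
    exact: smooth1_cst.
  rewrite (_ : (fun t => - _) = (fun t => cst (- r%:R) t * z t)).
    by apply: smooth1M => //; exact: smooth1_cst.
  by apply/funext => t; rewrite /cst mulNr.
have log_derive (u : R -> R) p t : u t != 0 ->
    derivable u t 1 /\ derive1 u t / u t = p -> is_derive t 1 u (p * u t).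
  move=> u0 [du <-]; apply: DeriveDef => //.
  by rewrite -derive1E divfK.
(* The logarithmic derivatives of [phi] and [h]; that of [f] is [X] itself. *)
pose P t := cst k t * X t; pose S t := X t * z t.
have dphi t : I t -> is_derive t 1 phi (P t * phi t).
  by move=> It; apply: log_derive; [exact: hphi0|rewrite /P /X -hsys2//; exact: hphi].
have f0 t : I t -> f t != 0 by move=> /hf0; exact: lt0r_neq0.
have df t : I t -> is_derive t 1 f (X t * f t).
  by move=> It; apply: log_derive; [exact: f0|rewrite /X -hsys2//; exact: hf].
have dh t : I t -> is_derive t 1 h (S t * h t).
  by move=> It; apply: log_derive; [exact: hh0|rewrite /S /X -hsys2//; exact: hh].
have sP : smooth1 I P by apply: smooth1M => //; exact: smooth1_cst.
have sS : smooth1 I S by exact: smooth1M.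
have sh : smooth1 I h by exact: (smooth1_ode hIo sS dh).
(* The metric contains only [f ^ 2] and [1 / phi ^ 2], which solve linear equations with the smooth
   coefficients [2 X] and [- 2 P]. *)
have sf2 : smooth1 I (fun t => f t ^+ 2).
  apply: (smooth1_ode hIo (g := fun t => cst 2 t * X t)).
    by apply: smooth1M => //; exact: smooth1_cst.
  by move=> t /df; exact: is_derive_log_sqr.
have sphi2 : smooth1 I (fun t => (phi t ^+ 2)^-1).
  apply: (smooth1_ode hIo (g := fun t => cst (- 2) t * P t)).
    by apply: smooth1M => //; exact: smooth1_cst.
  move=> t It; rewrite /cst mulNr.
  apply: (is_derive_logV (f := fun t => phi t ^+ 2)).
    by rewrite expf_neq0 ?hphi0.
  exact: is_derive_log_sqr (dphi _ It).
move=> U B xi gbar gtilde.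
have srg : semi_riemannian gtilde.
  exact: (warped_semi_riemannian alpha hIo hF heps hphi0 f0 sphi2 sf2).
split => //.
- exact: (smooth_function_xi hIo hF).
- by move=> p; apply: hh0; exact: (set_valU p.1).
move=> i p ip; have [_ ip2] := ip.
have mF : smooth_manifold F by case: hF.
have mC : smooth_manifold (product_atlas B F) by case: srg.
pose W := chart i.2 @` dom i.2; have oW : open W := image_dom_open mF (i := i.2).
pose G := coord_rep i (gtilde i); pose GF := coord_rep i.2 (gF i.2).
have [_ sgF _ symF _] := hF.
have symGF w : W w -> (GF w)^T = GF w.
  by move=> [q iq <-]; rewrite /GF (coord_repE mF) //; have [] := symF _ _ iq.
have unGF w : W w -> GF w \in unitmx.
  by move=> [q iq <-]; rewrite /GF (coord_repE mF) //; have [] := symF _ _ iq.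
have Dy : sep_dom alpha I W (chart i p).
  by rewrite -image_dom_sep; exists p.
have GE y : sep_dom alpha I W y -> G y =
    block_mx ((phi (linear_form alpha (lsubmx y)) ^+ 2)^-1 *: diag_mx eps) 0 0
      (f (linear_form alpha (lsubmx y)) ^+ 2 *: GF (rsubmx y)).
  by rewrite -image_dom_sep => /mem_set;
     exact: (@warped_metric_rep R n m eps alpha I phi f F gF hIo hF).
have eps2 := eps_sq heps.
have dP t : I t -> derivable P t 1 by exact: smooth1_derivable.
have dX1 t : I t -> derivable X t 1 by exact: smooth1_derivable.
have dS t : I t -> derivable S t 1 by exact: smooth1_derivable.
have qE : {in sep_dom alpha I W,
    coord_rep i (fun p => h (xi p.1)) =1 fun y => h (linear_form alpha (lsubmx y))}.
  rewrite -image_dom_sep; apply: (coord_rep_im mC) => q _.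
  by rewrite /= row_mxKl.
pose t := linear_form alpha (lsubmx (chart i p)).
have tE : xi p.1 = t by rewrite /t /= row_mxKl.
have It : I t by have [] := Dy.
have X'E : derive1 X t = (a - r%:R * z t) * X t ^+ 2.
  by rewrite derive1E; have [_ ->] := dX _ It.
have P'E : derive1 P t = k * derive1 X t.
  by rewrite !derive1E; exact: deriveMl (dX1 _ It).
have S'E : derive1 S t = X t * (X t * den (z t) / r%:R) + z t * derive1 X t.
  by rewrite -z' // !derive1E; exact: deriveM (dX1 _ It) (dz _ It).
have h0 : h t != 0 by exact: hh0.
have rF : ricci GF (rsubmx (chart i p)) = 0.
  by rewrite /= row_mxKr; exact: hFric ip2.
have rh0 : r%:R != 0 :> R by rewrite gt_eqF.
suff E u w : ricci G (chart i p) u w = r%:R / h t *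
    hessian G (coord_rep i (fun p => h (xi p.1))) (chart i p) u w.
  apply/eqP; rewrite scale0r subr_eq0 tE; apply/eqP/matrixP => u w.
  by rewrite [RHS]mxE; exact: E.
case: (split_ordP u) => u' ->; case: (split_ordP w) => w' ->.
- rewrite (ricci_ll hIo oW eps2 halpha (sgF i.2) symGF unGF hphi0 f0 dphi df
    dP dX1 GE _ _ Dy).
  rewrite (hessian_ll hIo oW eps2 halpha unGF hphi0 f0 dphi GE dh dS qE _ _ Dy).
  (* After division by [X ^ 2] the coefficient of [alpha_i alpha_j] is [r (r - 1) z ^ 2 - 2 r (k +
     a) z + a ^ 2 - b - den(z) = 0], and that of the delta term is a multiple of
     [a - r z - (n - 2) k + m + r z = 0]. *)
  rewrite -/t P'E S'E X'E /P /S /cst hden ha hb; field.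
  by apply/andP.
- rewrite (ricci_lr hIo oW eps2 (sgF i.2) symGF unGF hphi0 f0 dphi df GE _ _ Dy).
  by rewrite (hessian_lr hIo oW eps2 unGF hphi0 f0 GE qE _ _ Dy) mulr0.
- rewrite (ricci_rl hIo oW eps2 (sgF i.2) symGF unGF hphi0 f0 dphi df GE _ _ Dy).
  by rewrite (hessian_rl hIo oW eps2 unGF hphi0 f0 GE dh qE _ _ Dy) mulr0.
- rewrite (ricci_rr hIo oW eps2 halpha (sgF i.2) symGF unGF hphi0 f0 dphi df
    dX1 GE _ _ Dy).
  rewrite (hessian_rr hIo oW eps2 halpha unGF hphi0 f0 df GE dh qE _ _ Dy).
  (* With [Ric_F = 0], the remaining factor is [X ^ 2] times
     [(n - 2) k - (a - r z) - m - r z = 0]. *)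
  rewrite rF mxE -/t X'E /P /S /cst ha; field.
  by [].
Qed.
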